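(* Let $E$ be a field of characteristic different from $2$ and assume that $u(E')\leq 2$ for all finite field extensions $E'/E$. Let $f\in E[X]$ be square-free, not square-reflexive, and of minimal degree among all polynomials in $E[X]$ that are square-free and not square-reflexive. Then there exists an anisotropic $4$-dimensional quadratic form over $E(X)$ of determinant $fE(X)^{\times 2}$ which is isotropic over $E(X)_v$ for every $v\in\Omega_{E(X)/E}$.
   Context: $\Omega_{E(X)/E}$ is the set of all valuations $v$ on the rational function field $E(X)$ with value group $\mathbb{Z}$ such that $v(E^\times)=0$; $E(X)_v$ is the completion of $E(X)$ with respect to $v$. Quadratic forms are always regular (nondegenerate); a form is isotropic if it has a nontrivial zero, and anisotropic otherwise. The determinant of a form $\langle a_1,\dots,a_n\rangle=a_1X_1^2+\dots+a_nX_n^2$ over a field $F$ is the class $(a_1\cdots a_n)F^{\times 2}$. For a field $F$ of characteristic different from $2$, $u(F)\in\mathbb{N}\cup\{\infty\}$ is the supremum of the dimensions of anisotropic quadratic forms over $F$. For a commutative ring $R$ let $R^\times$ be its group of units and $R^{\times 2}=\{x^2\mid x\in R^\times\}$; an element of $R$ is square-free if it is not equal to $x^2y$ for any $x\in R\setminus R^\times$ and $y\in R$. For a nonzero $f\in E[X]$ put $E_f=E[X]/(f)$, let $\mathrm{N}_{E_f/E}:E_f\to E$ be the norm of this finite-dimensional $E$-algebra and let $\mathrm{lc}(f)$ be the leading coefficient of $f$. A square-free polynomial $f\in E[X]\setminus\{0\}$ is called square-reflexive if for every $\alpha\in E_f^\times$ with $\mathrm{N}_{E_f/E}(\alpha)\in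 E^{\times 2}\cup \mathrm{lc}(f)E^{\times 2}$ there exists a polynomial $g\in E[X]$ coprime to $f$ such that $g+(f)\in\alpha E_f^{\times 2}$ and $f+(g)\in E_g^{\times 2}$. *)

(* Defs.v *)
From HB Require Import structures.
From mathcomp Require Import all_boot all_order all_algebra all_field.

Set Implicit Arguments.
Unset Strict Implicit.
Unset Printing Implicit Defensive.

Import Order.TTheory GRing.Theory Num.Theory.
Local Open Scope ring_scope.

(** ** Quadratic forms, in characteristic different from 2 *)

(* The form with Gram matrix A; [diag_mx a] is <a_1, ..., a_n>. *)
Definition qform (F : fieldType) (n : nat) (A : 'M[F]_n) (x : 'rV[F]_n) : F :=
  (x *m A *m x^T) 0 0.

Definition regular_form (F : fieldType) (n : nat) (A : 'M[F]_n) : Prop :=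
  A^T = A /\ A \in unitmx.

Definition isotropic (F : fieldType) (n : nat) (A : 'M[F]_n) : Prop :=
  exists2 x : 'rV[F]_n, x != 0 & qform A x = 0.

Definition anisotropic (F : fieldType) (n : nat) (A : 'M[F]_n) : Prop :=
  ~ isotropic A.

(* The determinant of A is the square class of d. *)
Definition has_determinant (F : fieldType) (n : nat) (A : 'M[F]_n) (d : F) :
  Prop := exists2 c : F, c != 0 & \det A = d * c ^+ 2.

Lemma qform_diag (F : fieldType) (n : nat) (a x : 'rV[F]_n) :
  qform (diag_mx a) x = \sum_i a 0 i * x 0 i ^+ 2.
Proof.
rewrite /qform mxE; apply: eq_bigr => i _.
by rewrite mul_mx_diag !mxE mulrAC mulrC -expr2.
Qed.

Lemma has_determinant_diag (F : fieldType) (n : nat) (a : 'rV[F]_n) :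
  has_determinant (diag_mx a) (\prod_i a 0 i).
Proof. by exists 1; rewrite ?oner_eq0 // expr1n mulr1 det_diag. Qed.

(* u(F) <= m, where u(F) is the supremum of the dimensions of the anisotropic
   regular forms over F. *)
Definition u_le (F : fieldType) (m : nat) : Prop :=
  forall (n : nat) (A : 'M[F]_n), regular_form A -> anisotropic A -> (n <= m)%N.

(** ** Valuations with value group Z, and completions *)

(* A valuation is a function to int whose value at 0 is irrelevant. *)
Definition Zvaluation (K : fieldType) (v : K -> int) : Prop :=
  [/\ forall x y : K, x != 0 -> y != 0 -> v (x * y) = v x + v y,
      forall x y : K, x != 0 -> y != 0 -> x + y != 0 ->
        Num.min (v x) (v y) <= v (x + y)
    & forall k : int, exists2 x : K, x != 0 & v x = k].

Definition val_ge (K : fieldType) (v : K -> int) (k : int) (x : K) : Prop :=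
  x = 0 \/ k <= v x.

Definition val_cauchy (K : fieldType) (v : K -> int) (u : nat -> K) : Prop :=
  forall k : int, exists N : nat, forall m n : nat,
    (N <= m)%N -> (N <= n)%N -> val_ge v k (u m - u n).

Definition val_converges (K : fieldType) (v : K -> int) (u : nat -> K) (l : K) :
  Prop :=
  forall k : int, exists N : nat, forall n : nat,
    (N <= n)%N -> val_ge v k (u n - l).

(* (L, w), with the embedding iota, is a completion of (K, v). *)
Definition is_completion (K : fieldType) (v : K -> int)
    (L : fieldType) (iota : {rmorphism K -> L}) (w : L -> int) : Prop :=
  [/\ Zvaluation w,
      forall x : K, x != 0 -> w (iota x) = v x,
      forall u : nat -> L, val_cauchy w u -> exists l : L, val_converges w u l
    & forall (y : L) (k : int), exists x : K, val_ge w k (y - iota x)].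

(* The completion exists and is unique up to a unique isomorphism over K, so
   that a property of it may be read as one of any of its models. *)
Definition isotropic_over_completion (K : fieldType) (v : K -> int)
    (n : nat) (A : 'M[K]_n) : Prop :=
  forall (L : fieldType) (iota : {rmorphism K -> L}) (w : L -> int),
    is_completion v iota w -> isotropic (map_mx iota A).

(** ** The rational function field E(X) and Omega_{E(X)/E} *)

Definition ratfun (E : fieldType) : fieldType := {fraction {poly E}}.

Definition Omega (E : fieldType) (v : ratfun E -> int) : Prop :=
  Zvaluation v /\ forall c : E, c != 0 -> v (tofrac c%:P) = 0.

(** ** Square-reflexive polynomials *)

Definition square_free (R : comUnitRingType) (f : R) : Prop :=
  forall x y : R, f = x ^+ 2 * y -> x \is a GRing.unit.

(* Elements of E_f = E[X]/(f) are given by representatives in E[X]. The ring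
   types of MathComp for such quotients require f to be monic and nonconstant,
   whereas here E_f must be the zero ring when f is a nonzero constant. *)

Definition eq_mod (E : fieldType) (f a b : {poly E}) : Prop := f %| a - b.

Definition unit_mod (E : fieldType) (f a : {poly E}) : Prop :=
  exists b : {poly E}, eq_mod f (a * b) 1.

(* b + (f) is a + (f) times the square of a unit of E_f. *)
Definition in_square_class_mod (E : fieldType) (f a b : {poly E}) : Prop :=
  exists2 c : {poly E}, unit_mod f c & eq_mod f b (a * c ^+ 2).

(* The norm of a + (f): the determinant of multiplication by a on E_f, in the
   basis 1, X, ..., X^(deg f - 1). *)
Definition norm_mod (E : fieldType) (f a : {poly E}) : E :=
  \det (\matrix_(i < (size f).-1, j < (size f).-1) ((a * 'X^i) %% f)`_j).

Definition square_reflexive (E : fieldType) (f : {poly E}) : Prop :=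
  forall a : {poly E}, unit_mod f a ->
    (exists2 c : E, c != 0 &
       norm_mod f a = c ^+ 2 \/ norm_mod f a = lead_coef f * c ^+ 2) ->
    exists g : {poly E},
      [/\ g != 0, coprimep g f, in_square_class_mod f a g
        & in_square_class_mod g 1 f].

(* Main.v *)
Require Import Defs.
From HB Require Import structures.
From mathcomp Require Import all_boot all_order all_fingroup all_algebra.
From mathcomp Require Import all_field.
From mathcomp Require Import ring zify.
From Stdlib Require Import Classical.

Set Implicit Arguments.
Unset Strict Implicit.
Unset Printing Implicit Defensive.

Import Order.TTheory GRing.Theory Num.Theory.
Local Open Scope ring_scope.

(** A unit a of E[X]/(f) for which no reflecting polynomial exists is turned
    into a form <1, -hf, -g, hg>, where g represents a up to squares and
    constants.

    Existence of h.  The polynomial g is the square-free part of the remainder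
    of a modulo f, so it has smaller degree than f and is square-reflexive.
    Replacing g by a constant multiple leaves the norm of f in E[X]/(g)
    unchanged, and by choosing the constant this norm becomes lc(g).  Hence
    square-reflexivity applies to the class of f modulo g: there is h in the
    class of f modulo g, such that g is a square modulo h.  The determinant of
    <1, -hf, -g, hg> is f up to squares.

    Local isotropy.  At the place of an irreducible p, two entries are units
    with opposite square classes when p divides g or h; otherwise 1, -g, hg are
    units, and a ternary form over the residue field is isotropic since u <= 2
    ([residue_ternary]).  Hensel's lemma lifts these zeros
    ([approximate_zero_isotropic]).  At infinity only the degrees and the
    leading coefficients matter.  If deg f is odd, three entries have degrees
    of the same parity.  If deg f is even, the reciprocity law for norms
    ([norm_reciprocity]) expresses the norm of g modulo f by leading
    coefficients, and this norm is a square or lc(f) times a square: exactly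
    what makes two entries cancel ([isotropic_at_infinity_even_degree]).

    Anisotropy.  If f and h are coprime, the quaternion algebra (hf, g) is
    ramified at f, with residue the class of g, and at no other finite place.
    The form is isotropic if and only if this algebra is isomorphic to (f, G)
    for some G, and then the ramification of (f, G) makes G a reflecting
    polynomial.  Concretely, and for all f and h, a zero (x, y, z, w) of the
    form gives x^2 - g z^2 = -h V with V = g w^2 - f y^2.  Comparing the two
    sides at each irreducible p determines the square classes of f modulo the
    primes that divide V to an odd power, and of V modulo the primes of f.
    After multiplication by a norm from the extension by sqrt f, which makes it
    coprime to f, V yields a polynomial G in the class of g modulo f such that
    f is a square modulo G ([reflecting_polynomial]).  A constant multiple of G
    then lies in the class of a, which contradicts the choice of a. *)

(** * Factorization of polynomials *)

Section Factorization.

Variable E : fieldType.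
Implicit Types a b c p q r s t u v w x y : {poly E}.

Lemma irred_dvdpM p a b :
  irreducible_poly p -> (p %| a * b) = (p %| a) || (p %| b).
Proof.
move=> p_irr; apply/idP/orP => [|[]]; last 2 first.
- exact: dvdp_mulr.
- exact: dvdp_mull.
have [pa|] := boolP (p %| a); first by left.
by rewrite -irreducible_poly_coprime // => /Gauss_dvdpr -> pb; right.
Qed.

Lemma irred_dvdpX2 p a : irreducible_poly p -> (p %| a ^+ 2) = (p %| a).
Proof. by move=> p_irr; rewrite expr2 irred_dvdpM // orbb. Qed.

Lemma irred_dvdp_const p c : irreducible_poly p -> size c = 1%N -> ~~ (p %| c).
Proof.
move=> [p_gt1 _] c1; apply/negP => /dvdp_leq.
by rewrite -size_poly_gt0 c1 => /(_ isT); rewrite leqNgt p_gt1.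
Qed.

Lemma size_quotient p b : (1 < size p)%N -> b != 0 -> (size b < size
  (p * b)%R)%N.
Proof.
move=> p_gt1 b0; have p0 : p != 0 by rewrite -size_poly_gt0 ltnW.
have b_gt0 : (0 < size b)%N by rewrite size_poly_gt0.
by rewrite size_mul // -subn1; move: p_gt1 b_gt0; move: (size p) (size b); lia.
Qed.

Lemma irred_divisor a : (1 < size a)%N -> exists2 p,
  irreducible_poly p & p %| a.
Proof.
have [n] := ubnP (size a); elim: n a => // n IH a /ltnSE a_le a_gt1.
have [a_irr|a_red] := classic (irreducible_poly a); first by exists a.
have [b [b1 ba bNa]] : exists b, [/\ size b != 1%N, b %| a & ~~ (b %= a)].
  apply: NNPP => noB; apply: a_red; split=> // b b1 ba.
  by apply/negPn/negP => bNa; apply: noB; exists b.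
have a0 : a != 0 by rewrite -size_poly_gt0 ltnW.
have b0 : b != 0 by apply: contraTneq ba => ->; rewrite dvd0p.
have b_gt1 : (1 < size b)%N.
  by rewrite ltn_neqAle eq_sym b1 size_poly_gt0.
have b_lt : (size b < n)%N.
  apply: leq_trans a_le.
  by rewrite ltn_neqAle dvdp_size_eqp // bNa dvdp_leq.
have [p p_irr pb] := IH b b_lt b_gt1.
by exists p => //; apply: dvdp_trans ba.
Qed.

Lemma irred_ind (P : {poly E} -> Prop) :
    (forall c, size c = 1%N -> P c) ->
    (forall p b, irreducible_poly p -> b != 0 -> P b -> P (p * b)) ->
  forall a, a != 0 -> P a.
Proof.
move=> Pconst PM a; have [n] := ubnP (size a);
  elim: n a => // n IH a /ltnSE a_le a0.
have [a_gt1|a_le1] := ltnP 1 (size a); last first.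
  by apply: Pconst; apply/eqP; rewrite eqn_leq a_le1 size_poly_gt0.
have [p p_irr /dvdpP [b Da]] := irred_divisor a_gt1.
have b0 : b != 0 by apply: contraNneq a0 => b0; rewrite Da b0 mul0r.
rewrite Da mulrC in a_le *; apply: PM => //; apply: IH => //.
by apply: leq_trans a_le; rewrite size_quotient // p_irr.1.
Qed.

Lemma unit_polyE a : (a \is a GRing.unit) = (size a == 1%N).
Proof.
rewrite poly_unitE; apply: andb_idr => /size_poly1P[c c0 ->].
by rewrite coefC unitfE.
Qed.

Lemma square_free_neq0 (f : {poly E}) : square_free f -> f != 0.
Proof.
move=> fsq; apply/eqP => f0; have := fsq 0 0.
by rewrite f0 mulr0 unitr0 => /(_ erefl).
Qed.

Lemma square_free_dvd (f b : {poly E}) : square_free f -> b %| f ->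
  square_free b.
Proof.
move=> fsq /dvdpP [c Df] x y Db; apply: (fsq x (c * y)).
by rewrite Df Db; ring.
Qed.

Lemma square_free_coprimeM a b : square_free (a * b) -> coprimep a b.
Proof.
move=> absq; have := square_free_neq0 absq.
rewrite mulf_eq0 negb_or => /andP [a0 b0].
rewrite coprimep_def -unit_polyE; set d := gcdp a b.
have /dvdpP [a' Da] : d %| a by apply: dvdp_gcdl.
have /dvdpP [b' Db] : d %| b by apply: dvdp_gcdr.
by apply: (absq d (a' * b')); clearbody d; rewrite Da Db; ring.
Qed.

Lemma square_free_part a :
  a != 0 -> exists s b, [/\ a = s ^+ 2 * b, s != 0 & square_free b].
Proof.
have [n] := ubnP (size a); elim: n a => // n IH a /ltnSE a_le a0.
have [asq|aNsq] := classic (square_free a).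
  by exists 1, a; rewrite expr1n mul1r oner_neq0.
have [x [y [Da xNu]]] : exists x y, a = x ^+ 2 * y /\ x \isn't a GRing.unit.
  apply: NNPP => noxy; apply: aNsq => x y Da.
  by apply/negPn/negP => xNu; apply: noxy; exists x, y.
move: (a0); rewrite Da mulf_eq0 expf_eq0 /= negb_or => /andP [x0 y0].
have x_gt1 : (1 < size x)%N.
  by rewrite ltn_neqAle eq_sym -unit_polyE xNu size_poly_gt0.
have [|//|s [b [Dy s0 bsq]]] := IH y.
  apply: leq_trans a_le; rewrite Da expr2 -mulrA.
  apply: leq_trans (size_quotient x_gt1 y0) _.
  by apply: ltnW; rewrite size_quotient // mulf_neq0.
exists (x * s), b; split; rewrite ?mulf_neq0 //.
by rewrite Dy; ring.
Qed.

End Factorization.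

(** * Squares modulo an irreducible polynomial *)

Definition sq_mod (E : fieldType) (p u : {poly E}) : Prop :=
  exists c : {poly E}, p %| u - c ^+ 2.

Section SquaresModIrreducible.

Variables (E : fieldType) (p : {poly E}).
Hypothesis p_irr : irreducible_poly p.
Implicit Types a b c d s t u v x y : {poly E}.

Lemma sq_modX2 c : sq_mod p (c ^+ 2).
Proof. by exists c; rewrite subrr dvdp0. Qed.

Lemma sq_mod_eq u v : p %| u - v -> sq_mod p u -> sq_mod p v.
Proof.
move=> uv [c uc]; exists c.
have -> : v - c ^+ 2 = u - c ^+ 2 - (u - v) by ring.
exact: dvdp_sub.
Qed.

Lemma sq_modM u v : sq_mod p u -> sq_mod p v -> sq_mod p (u * v).
Proof.
move=> [c uc] [d vd]; exists (c * d).
have -> : u * v - (c * d) ^+ 2 = (u - c ^+ 2) * v + c ^+ 2 * (v - d ^+ 2)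
  by ring.
by apply: dvdp_add; [apply: dvdp_mulr | apply: dvdp_mull].
Qed.

Lemma inv_mod c : ~~ (p %| c) -> exists d, p %| c * d - 1.
Proof.
rewrite -irreducible_poly_coprime // => /Bezout_eq1_coprimepP [[a b] /= Dab].
exists b; rewrite -Dab (_ : _ - _ = - a * p); last by ring.
exact: dvdp_mull.
Qed.

Lemma sq_mod_divX2 u c : ~~ (p %| c) -> sq_mod p (c ^+ 2 * u) -> sq_mod p u.
Proof.
move=> pNc ucsq; have [d cd] := inv_mod pNc.
apply: sq_mod_eq (sq_modM (sq_modX2 d) ucsq).
have -> : d ^+ 2 * (c ^+ 2 * u) - u = (c * d - 1) * ((c * d + 1) * u) by ring.
exact: dvdp_mulr.
Qed.

Lemma sq_mod_cancel u v :
  ~~ (p %| u) -> sq_mod p u -> sq_mod p (u * v) -> sq_mod p v.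
Proof.
move=> pNu usq uvsq; apply: (sq_mod_divX2 pNu).
by rewrite expr2 -mulrA; apply: sq_modM.
Qed.

End SquaresModIrreducible.

(** * Square classes read off from binary forms *)

Section BinaryFormDescent.

Variables (E : fieldType) (p : {poly E}).
Hypothesis p_irr : irreducible_poly p.
Implicit Types s t u v x y : {poly E}.

Let p0 : p != 0. Proof. exact: irredp_neq0. Qed.

Let p_factor a : p %| a -> exists b, a = p * b.
Proof. by case/dvdpP=> b ->; exists b; rewrite mulrC. Qed.

Let size_divp b : p * b != 0 -> (size b < size (p * b)%R)%N.
Proof.
by rewrite mulf_eq0 negb_or => /andP [_ b0]; rewrite size_quotient // p_irr.1.
Qed.

(** An odd power of p in a value of <u, -v> forces a zero of <u, -v> modulo p:
    once the common factors p of x, y and s are removed, x and y are prime to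
    p. *)
Lemma sq_mod_unit_form u v s t x y :
    ~~ (p %| u) -> ~~ (p %| v) -> p %| t -> ~~ (p ^+ 2 %| t) -> s != 0 ->
  u * x ^+ 2 - v * y ^+ 2 = s ^+ 2 * t -> sq_mod p (u * v).
Proof.
move=> pNu pNv pt p2Nt; have [n] := ubnP (size s).
elim: n s x y => // n IH s x y /ltnSE s_le s0 Dst.
have p_form : p %| u * x ^+ 2 - v * y ^+ 2 by rewrite Dst dvdp_mull.
have [py|pNy] := boolP (p %| y); last first.
  apply: (sq_mod_divX2 p_irr pNy); exists (u * x).
  have -> : y ^+ 2 * (u * v) - (u * x) ^+ 2
    = - u * (u * x ^+ 2 - v * y ^+ 2) by ring.
  exact: dvdp_mull.
have px : p %| x.
  have pvy : p %| v * y ^+ 2 by apply: dvdp_mull; rewrite irred_dvdpX2.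
  move: p_form; rewrite (dvdp_subl _ pvy).
  by rewrite irred_dvdpM // (negPf pNu) irred_dvdpX2.
have [x' Dx] := p_factor px; have [y' Dy] := p_factor py.
have Dst' : s ^+ 2 * t = p ^+ 2 * (u * x' ^+ 2 - v * y' ^+ 2).
  by rewrite -Dst Dx Dy; ring.
have ps : p %| s.
  apply: contraNT p2Nt => pNs; have : p ^+ 2 %| s ^+ 2 * t
    by rewrite Dst' dvdp_mulr.
  by rewrite Gauss_dvdpr // coprimep_expl // coprimep_expr // irreducible_poly_coprime.
have [s' Ds] := p_factor ps; rewrite Ds in s_le s0 Dst'.
apply: (IH s' x' y').
- exact: leq_trans (size_divp s0) s_le.
- by apply: contraNneq s0 => ->; rewrite mulr0.
- by apply: (mulfI (expf_neq0 2 p0)); rewrite -Dst'; ring.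
Qed.

(** A value of <u, -pv> of even order is dominated by its first term. *)
Lemma sq_mod_ramified_form u v s t x y :
    ~~ (p %| u) -> ~~ (p %| v) -> ~~ (p %| t) -> s != 0 ->
  u * x ^+ 2 - p * v * y ^+ 2 = s ^+ 2 * t -> sq_mod p (u * t).
Proof.
move=> pNu pNv pNt; have [n] := ubnP (size s).
elim: n s x y => // n IH s x y /ltnSE s_le s0 Dst.
have [ps|pNs] := boolP (p %| s); last first.
  apply: (sq_mod_divX2 p_irr pNs); exists (u * x).
  have -> : s ^+ 2 * (u * t) - (u * x) ^+ 2
    = p * (- u * v * y ^+ 2) + u * (s ^+ 2 * t - (u * x ^+ 2 - p * v * y ^+ 2))
      by ring.
  by rewrite Dst subrr mulr0 addr0 dvdp_mulr.
have [s' Ds] := p_factor ps; rewrite Ds in s_le s0 Dst.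
have px : p %| x.
  have : p %| u * x ^+ 2.
    rewrite -(subrK (p * v * y ^+ 2) (u * _)) Dst.
    have -> : (p * s') ^+ 2 * t + p * v * y ^+ 2
      = p * (p * s' ^+ 2 * t + v * y ^+ 2) by ring.
    exact: dvdp_mulr.
  by rewrite irred_dvdpM // (negPf pNu) irred_dvdpX2.
have [x' Dx] := p_factor px; rewrite Dx in Dst.
have py : p %| y.
  have : p %| v * y ^+ 2.
    have -> : v * y ^+ 2 = p * (u * x' ^+ 2 - s' ^+ 2 * t).
      apply: (mulfI p0).
      transitivity (u * (p * x') ^+ 2 - (u * (p * x') ^+ 2 - p * v * y ^+ 2)).
        by ring.
      by rewrite Dst; ring.
    exact: dvdp_mulr.
  by rewrite irred_dvdpM // (negPf pNv) irred_dvdpX2.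
have [y' Dy] := p_factor py; rewrite Dy in Dst.
apply: (IH s' x' y').
- exact: leq_trans (size_divp s0) s_le.
- by apply: contraNneq s0 => ->; rewrite mulr0.
- apply: (mulfI (expf_neq0 2 p0)).
  by rewrite [RHS]mulrA -exprMn -Dst; ring.
Qed.

(** A value of <u, -pv> of odd order is dominated by its second term: dividing
    by p exchanges the roles of the two terms. *)
Lemma sq_mod_ramified_form_odd u v s t x y :
    ~~ (p %| u) -> ~~ (p %| v) -> ~~ (p %| t) -> s != 0 ->
  u * x ^+ 2 - p * v * y ^+ 2 = s ^+ 2 * (p * t) -> sq_mod p (- v * t).
Proof.
move=> pNu pNv pNt s0 Dst.
have px : p %| x.
  have : p %| u * x ^+ 2.
    rewrite -(subrK (p * v * y ^+ 2) (u * _)) Dst.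
    have -> : s ^+ 2 * (p * t) + p * v * y ^+ 2
      = p * (s ^+ 2 * t + v * y ^+ 2) by ring.
    exact: dvdp_mulr.
  by rewrite irred_dvdpM // (negPf pNu) irred_dvdpX2.
have [x' Dx] := p_factor px; rewrite Dx in Dst.
apply: (@sq_mod_ramified_form _ (- u) s t y x'); rewrite ?dvdpNr //.
by apply: (mulfI p0); rewrite [RHS]mulrCA -Dst; ring.
Qed.

Lemma ramified_form_anisotropic u v x y :
    ~~ (p %| u) -> ~~ (p %| v) -> u * x ^+ 2 = p * v * y ^+ 2 -> y = 0.
Proof.
move=> pNu pNv; have [n] := ubnP (size y).
elim: n x y => // n IH x y /ltnSE y_le Dxy.
apply/eqP/negPn/negP => y0.
have px : p %| x.
  have : p %| u * x ^+ 2 by rewrite Dxy -mulrA dvdp_mulr.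
  by rewrite irred_dvdpM // (negPf pNu) irred_dvdpX2.
have [x' Dx] := p_factor px; rewrite Dx in Dxy.
have Dy : v * y ^+ 2 = p * (u * x' ^+ 2).
  by apply: (mulfI p0); rewrite [LHS]mulrA -Dxy; ring.
have py : p %| y.
  have : p %| v * y ^+ 2 by rewrite Dy dvdp_mulr.
  by rewrite irred_dvdpM // (negPf pNv) irred_dvdpX2.
have [y' Dy'] := p_factor py; rewrite Dy' in y_le y0 Dy.
have y'0 : y' = 0.
  apply: (IH x' y'); first exact: leq_trans (size_divp y0) y_le.
  by apply: (mulfI p0); rewrite -Dy; ring.
by rewrite y'0 mulr0 eqxx in y0.
Qed.

End BinaryFormDescent.

(** Chinese remaindering glues the square roots, one prime factor at a time. *)
Lemma sqrt_mod (E : fieldType) (r u : {poly E}) :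
    square_free r -> (forall p, irreducible_poly p -> p %| r -> sq_mod p u) ->
  exists c, r %| u - c ^+ 2.
Proof.
move=> rsq; have r0 := square_free_neq0 rsq; move: r r0 rsq.
apply: irred_ind => [k k1 _ _|p b p_irr b0 IH pbsq loc].
  by exists 0; apply: dvdp_trans (dvd1p _); rewrite dvdp1 k1.
have [|q q_irr qb|c bc] := IH _ _.
- by apply: square_free_dvd pbsq _; rewrite dvdp_mull.
- by apply: loc => //; apply: dvdp_mull.
have [d pd] := loc p p_irr (dvdp_mulIl _ _).
have pb := square_free_coprimeM pbsq.
have /Bezout_eq1_coprimepP [[k l] /= Dkl] := pb.
exists (c * (k * p) + d * (l * b)); rewrite Gauss_dvdp //; apply/andP; split.
- have -> : u - (c * (k * p) + d * (l * b)) ^+ 2 = (u - d ^+ 2) +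
     (d ^+ 2 * (1 - l * b) * (1 + l * b) - p * (k * c *
       (c * k * p + 2 * d * l * b))) by ring.
  rewrite (_ : 1 - l * b = k * p); last by rewrite -Dkl addrK.
  apply: (dvdp_add pd); apply: dvdp_sub; last exact: dvdp_mulr.
  by apply: dvdp_mulr; apply: dvdp_mull; apply: dvdp_mull.
- have -> : u - (c * (k * p) + d * (l * b)) ^+ 2 = (u - c ^+ 2) +
     (c ^+ 2 * (1 - k * p) * (1 + k * p) - b * (l * d *
       (d * l * b + 2 * c * k * p))) by ring.
  rewrite (_ : 1 - k * p = l * b); last by rewrite -Dkl addrC addKr.
  apply: (dvdp_add bc); apply: dvdp_sub; last exact: dvdp_mulr.
  by apply: dvdp_mulr; apply: dvdp_mull; apply: dvdp_mull.
Qed.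

(** * Reflecting polynomials from isotropic vectors *)

Lemma simple_factor (E : fieldType) (p a : {poly E}) :
    irreducible_poly p -> square_free a -> p %| a ->
  exists2 b, a = p * b & ~~ (p %| b).
Proof.
move=> p_irr asq /dvdpP [b Da]; rewrite mulrC in Da.
exists b => //; rewrite -irreducible_poly_coprime //.
by apply: square_free_coprimeM; rewrite -Da.
Qed.

Lemma coprimep_irred_ndvd (E : fieldType) (p a b : {poly E}) :
  irreducible_poly p -> coprimep a b -> p %| a -> ~~ (p %| b).
Proof. by move=> p_irr ab pa; rewrite -irreducible_poly_coprime //
  (coprimep_dvdr pa ab). Qed.

Lemma simple_dvdX2 (E : fieldType) (p b : {poly E}) :
  irreducible_poly p -> ~~ (p %| b) -> ~~ (p ^+ 2 %| p * b).
Proof. by move=> p_irr; rewrite expr2 dvdp_mul2l ?(irredp_neq0 p_irr). Qed.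

Lemma coprimep_irredP (E : fieldType) (a b : {poly E}) :
    a != 0 -> (forall p, irreducible_poly p -> p %| a -> ~~ (p %| b)) ->
  coprimep a b.
Proof.
move=> a0 ab; have d0 : gcdp a b != 0 by rewrite gcdp_eq0 negb_and a0.
rewrite coprimep_def eqn_leq size_poly_gt0 d0 andbT leqNgt.
apply/negP => /irred_divisor [p p_irr]; rewrite dvdp_gcd => /andP [pa].
exact/negP/ab.
Qed.

Section Reflection.

Variables (E : fieldType) (f g h : {poly E}).
Hypotheses (fsq : square_free f) (f_gt1 : (1 < size f)%N) (gsq : square_free g).
Hypotheses (fg : coprimep f g) (hg : coprimep h g).
Hypothesis hf_sq : forall p, irreducible_poly p -> p %| g -> sq_mod p (h * f).
Hypothesis g_sq : forall p, irreducible_poly p -> p %| h -> sq_mod p g.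

Section ValueClasses.

Variables (s G w x y z p : {poly E}).
Hypotheses (Gsq : square_free G) (s0 : s != 0) (p_irr : irreducible_poly p).
Hypothesis Dfg : g * w ^+ 2 - f * y ^+ 2 = s ^+ 2 * G.
Hypothesis Dgh : x ^+ 2 - g * z ^+ 2 = s ^+ 2 * (- h * G).

(** The primes of G divide the value -hG of <1, -g> to an odd power unless they
    divide h, where g is a square by hypothesis. *)
Lemma g_sq_at_ramified : p %| G -> ~~ (p %| g) -> sq_mod p g.
Proof.
move=> pG pNg; have [/g_sq|pNh] := boolP (p %| h); first exact.
have [G' DG pNG'] := simple_factor p_irr Gsq pG.
rewrite -[g]mul1r.
apply: (@sq_mod_unit_form _ p p_irr 1 g s (- h * G) x z) => //.
- by rewrite irred_dvdp_const ?size_poly1.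
- exact: dvdp_mull.
- rewrite DG mulrCA simple_dvdX2 // irred_dvdpM // dvdpNr.
  by rewrite (negPf pNh) (negPf pNG').
- by rewrite mul1r.
Qed.

(** Away from g, both f g (as G is a value of <g, -f>) and g are squares modulo
    p.  At a prime of g, write g = p g' and G = p G'.  The two equations make
    g' G' and g' G' h squares modulo p, hence also h, and f with it. *)
Lemma f_sq_at_value : p %| G -> ~~ (p %| f) -> sq_mod p f.
Proof.
move=> pG pNf; have [G' DG pNG'] := simple_factor p_irr Gsq pG.
have [pg|pNg] := boolP (p %| g); last first.
  apply: (sq_mod_cancel p_irr pNg (g_sq_at_ramified pG pNg)).
  apply: (@sq_mod_unit_form _ p p_irr g f s G w y) => //.
  by rewrite DG simple_dvdX2.
have pNh : ~~ (p %| h) by apply: coprimep_irred_ndvd pg;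
  rewrite // coprimep_sym.
have [g' Dg pNg'] := simple_factor p_irr gsq pg.
have gG : sq_mod p (g' * G').
  have := @sq_mod_ramified_form_odd _ p p_irr (- f) (- g') s G' y w.
  rewrite !dvdpNr opprK; apply=> //.
  by rewrite -DG -Dfg Dg; ring.
have ghG : sq_mod p (g' * G' * h).
  have := @sq_mod_ramified_form_odd _ p p_irr 1 g' s (- h * G') x z.
  rewrite irred_dvdp_const ?size_poly1 // irred_dvdpM // dvdpNr.
  rewrite (negPf pNh) (negPf pNG') (_ : - g' * _ = g' * G' * h); last by ring.
  apply=> //; rewrite mul1r -Dg Dgh DG; ring.
have pNgG : ~~ (p %| g' * G') by rewrite irred_dvdpM // negb_or pNg'.
apply: (sq_mod_cancel p_irr pNh); last exact: hf_sq.
exact: sq_mod_cancel ghG.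
Qed.

Lemma value_class_unramified : p %| f -> ~~ (p %| G) -> sq_mod p (g * G).
Proof.
move=> pf pNG; have [f' Df pNf'] := simple_factor p_irr fsq pf.
apply: (@sq_mod_ramified_form _ p p_irr g f' s G w y) => //.
  exact: coprimep_irred_ndvd fg pf.
by rewrite -Df.
Qed.

Lemma value_class_ramified f' G' :
  f = p * f' -> G = p * G' -> sq_mod p (- f' * G').
Proof.
move=> Df DG.
have pf : p %| f by rewrite Df dvdp_mulIl.
apply: (@sq_mod_ramified_form_odd _ p p_irr g f' s G' w y) => //.
- exact: coprimep_irred_ndvd fg pf.
- by rewrite -irreducible_poly_coprime //; apply: square_free_coprimeM;
    rewrite -Df.
- by rewrite -irreducible_poly_coprime //; apply: square_free_coprimeM;
    rewrite -DG.
- by rewrite -Df -DG.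
Qed.

End ValueClasses.

(** The square-free part of V may share a divisor d with f = d f'.  Writing it
    as d G', the product with the norm d^2 - f = d (d - f') is d^2 times
    G' (d - f'), which is coprime to f: this is the polynomial whose square-free
    part is returned. *)
Lemma reflecting_polynomial (w x y z : {poly E}) :
    [|| w != 0, x != 0, y != 0 | z != 0] ->
    x ^+ 2 - h * f * y ^+ 2 - g * z ^+ 2 + h * g * w ^+ 2 = 0 ->
  exists G, [/\ square_free G,
    forall p, irreducible_poly p -> p %| G -> ~~ (p %| f) /\ sq_mod p f
    & forall p, irreducible_poly p -> p %| f -> sq_mod p (g * G)].
Proof.
move=> nz Dxyzw; have f0 := square_free_neq0 fsq;
  have g0 := square_free_neq0 gsq.
pose V := g * w ^+ 2 - f * y ^+ 2.
have DV : x ^+ 2 - g * z ^+ 2 = - h * V.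
  by apply/eqP; rewrite -subr_eq0 -Dxyzw /V; apply/eqP; ring.
have [V0|V0] := eqVneq V 0.
  (* Here y = w = 0, so g is a square in E(X), and G = 1 reflects. *)
  have y0 : y = 0.
    have [p p_irr pf] := irred_divisor f_gt1.
    have [f' Df pNf'] := simple_factor p_irr fsq pf.
    apply: (@ramified_form_anisotropic _ p p_irr g f' w) => //.
      exact: coprimep_irred_ndvd fg pf.
    by rewrite -Df; apply/eqP; rewrite -subr_eq0 -/V V0.
  have w0 : w = 0.
    move/eqP: V0; rewrite /V y0 expr0n mulr0 subr0 mulf_eq0 (negPf g0) /=.
    by rewrite expf_eq0 => /eqP.
  have Dx : x ^+ 2 = g * z ^+ 2.
    by apply/eqP; rewrite -subr_eq0 DV V0 mulr0.
  have z0 : z != 0.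
    apply: contraTneq nz => z0; move/eqP: Dx.
    by rewrite z0 expr0n mulr0 expf_eq0 /= w0 y0 => ->; rewrite eqxx.
  exists 1; split=> [a b D1|p p_irr p1|p p_irr pf].
  - apply/unitrP; exists (a * b); split; rewrite D1; ring.
  - by case/negP: (irred_dvdp_const p_irr (size_poly1 E)).
  - rewrite mulr1 -[g]mul1r.
    have pN1 : ~~ (p %| 1) by rewrite irred_dvdp_const ?size_poly1.
    apply: (@sq_mod_ramified_form _ p p_irr 1 1 z g x 0) => //.
      exact: coprimep_irred_ndvd fg pf.
    by rewrite expr0n mulr0 subr0 mul1r Dx mulrC.
have [s [G [DVG s0 Gsq]]] := square_free_part V0.
have G0 := square_free_neq0 Gsq.
have Dfg : g * w ^+ 2 - f * y ^+ 2 = s ^+ 2 * G by rewrite -DVG.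
have Dgh : x ^+ 2 - g * z ^+ 2 = s ^+ 2 * (- h * G) by rewrite DV DVG; ring.
pose d := gcdp G f.
have /dvdpP [G' DG] : d %| G by apply: dvdp_gcdl.
have /dvdpP [f' Df] : d %| f by apply: dvdp_gcdr.
have df' : coprimep d f' by apply: square_free_coprimeM; rewrite mulrC -Df.
have dG' : coprimep d G' by apply: square_free_coprimeM; rewrite mulrC -DG.
have d0 : d != 0 by apply: contraNneq f0; rewrite Df => ->; rewrite mulr0.
have G'0 : G' != 0 by apply: contraNneq G0; rewrite DG => ->; rewrite mul0r.
(* If d = f' then f = d^2 is constant. *)
have ddf : d - f' != 0.
  rewrite subr_eq0; apply: contraTneq f_gt1 => ddf.
  have /eqP d1 : size d == 1%N by rewrite -unit_polyE; apply: (fsq (y := 1));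
    rewrite Df -ddf; ring.
  by rewrite Df -ddf size_mul // d1.
have W0 : G' * (d - f') != 0 by rewrite mulf_neq0.
have [r [G3 [DW r0 G3sq]]] := square_free_part W0.
have pdf p : irreducible_poly p -> p %| f -> p %| G -> p %| d.
  by move=> _ pf pG; rewrite dvdp_gcd pG.
have WNf p : irreducible_poly p -> p %| f -> ~~ (p %| G' * (d - f')).
  move=> p_irr pf; rewrite irred_dvdpM // negb_or; have := pf.
  have [pd _|pNd] := boolP (p %| d).
    rewrite (coprimep_irred_ndvd p_irr dG' pd) (dvdp_subr _ pd).
    exact: coprimep_irred_ndvd pd.
  rewrite Df irred_dvdpM // (negPf pNd) orbF => pf'.
  rewrite (dvdp_subl _ pf') pNd andbT.
  by apply: contra pNd => pG'; apply: pdf; rewrite // DG dvdp_mulr.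
exists G3; split=> // p p_irr pG.
  have pW : p %| G' * (d - f') by rewrite DW dvdp_mull.
  have pNf : ~~ (p %| f) by apply: contraL pW; apply: WNf.
  split=> //; move: pW; rewrite irred_dvdpM // => /orP [pG'|pdf'].
    apply: (f_sq_at_value Gsq s0 p_irr Dfg Dgh) => //.
    by rewrite DG dvdp_mulr.
  apply: sq_mod_eq (sq_modX2 p d).
  by rewrite Df (_ : _ - _ = d * (d - f')) ?dvdp_mull //; ring.
(* Modulo a prime of d, G' (d - f') is -f' G'; modulo a prime of f' it is G. *)
rename pG into pf; have pNW := WNf p p_irr pf.
have pNr : ~~ (p %| r).
  by apply: contra pNW => pr; rewrite DW dvdp_mulr // irred_dvdpX2.
apply: (sq_mod_divX2 p_irr pNr).
rewrite (_ : _ * (g * _) = g * (G' * (d - f'))); last by rewrite DW; ring.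
have [pd|pNd] := boolP (p %| d).
  have [pG pNg] : p %| G /\ ~~ (p %| g).
    by split; [rewrite DG dvdp_mull | apply: coprimep_irred_ndvd fg pf].
  apply: sq_modM; first exact: (g_sq_at_ramified Gsq s0 p_irr Dgh).
  have /dvdpP [d' Dd] := pd.
  have pNd' : ~~ (p %| d').
    have dsq : square_free (d' * p).
      by rewrite -Dd; apply: square_free_dvd fsq _; rewrite Df dvdp_mulIr.
    by rewrite -irreducible_poly_coprime // coprimep_sym;
      apply: square_free_coprimeM.
  apply: (@sq_mod_eq _ _ (- f' * G')).
    by rewrite (_ : _ - _ = d * - G') ?dvdp_mulr //; ring.
  apply: (sq_mod_divX2 p_irr pNd').
  have -> : d' ^+ 2 * (- f' * G') = - (d' * f') * (d' * G') by ring.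
  by apply: (value_class_ramified Gsq s0 p_irr Dfg); rewrite (DG, Df) Dd; ring.
have pNG : ~~ (p %| G) by apply: contra pNd => ?; apply: pdf.
have pf' : p %| f' by move: pf; rewrite Df irred_dvdpM // (negPf pNd) orbF.
apply: sq_mod_eq (value_class_unramified s0 p_irr Dfg pf pNG).
by rewrite DG (_ : _ - _ = f' * (g * G')) ?dvdp_mulr //; ring.
Qed.

End Reflection.

(** * Norms and their reciprocity law *)

Section NormAlgebra.

Variable E : fieldType.
Implicit Types f g a b u : {poly E}.

Definition mul_mx f a : 'M[E]_((size f).-1) :=
  \matrix_(i, j) ((a * 'X^i) %% f)`_j.

Lemma size_modp_deg f a : f != 0 -> (size (a %% f)%R <= (size f).-1)%N.
Proof.
move=> f0; have : (size (a %% f)%R < size f)%N by rewrite ltn_modp.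
by case: (size f).
Qed.

Lemma mul_mxE f a (u : 'rV_((size f).-1)) j :
  (u *m mul_mx f a) 0 j = ((a * rVpoly u) %% f)`_j.
Proof.
rewrite mxE -[in RHS](mul1mx u) /rVpoly poly_def mulr_sumr.
rewrite (big_morph (fun r => r %% f) (@modpD E f) (mod0p f)) coef_sum.
apply: eq_bigr => i _; rewrite mxE insubT // => lti.
by rewrite mul1mx (_ : Sub _ _ = i) ?valK -?scalerAr ?modpZl ?coefZ //;
  apply: val_inj.
Qed.

Lemma mul_mxM f a b : f != 0 -> mul_mx f (a * b) = mul_mx f b *m mul_mx f a.
Proof.
move=> f0; apply/row_matrixP => i; rewrite row_mul; apply/rowP => j.
rewrite mul_mxE [row i _ in RHS](_ : _ = poly_rV ((b * 'X^i) %% f)).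
  by rewrite poly_rV_K ?size_modp_deg // modp_mul mulrA !mxE.
by apply/rowP => k; rewrite !mxE.
Qed.

Lemma norm_modE f a : norm_mod f a = \det (mul_mx f a).
Proof. by []. Qed.

Lemma norm_modM f a b : f != 0 -> norm_mod f (a * b) =
  norm_mod f a * norm_mod f b.
Proof. by move=> f0; rewrite !norm_modE mul_mxM // det_mulmx mulrC. Qed.

Lemma norm_mod_eq f a b : f %| a - b -> norm_mod f a = norm_mod f b.
Proof.
move=> fab; rewrite !norm_modE; congr (\det _); apply/matrixP => i j.
rewrite !mxE; congr (_`_j); rewrite -[a](subrK b) mulrDl modpD.
by rewrite (modp_eq0 (dvdp_mulr _ fab)) add0r.
Qed.

Lemma norm_modC f (c : E) : f != 0 -> norm_mod f c%:P = c ^+ (size f).-1.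
Proof.
move=> f0; rewrite norm_modE -det_scalar; congr (\det _).
apply/matrixP => i j; rewrite !mxE mul_polyC modpZl modp_small ?coefZ ?coefXn.
  by rewrite eq_sym mulr_natr.
by rewrite size_polyXn -ltn_predRL.
Qed.

Lemma norm_mod1 f : f != 0 -> norm_mod f 1 = 1.
Proof. by move=> f0; rewrite -[1]/(1%:P) norm_modC // expr1n. Qed.

Lemma norm_modX2 f a : f != 0 -> norm_mod f (a ^+ 2) = norm_mod f a ^+ 2.
Proof. by move=> f0; rewrite expr2 norm_modM. Qed.

Lemma norm_mod_neq0 f a : f != 0 -> unit_mod f a -> norm_mod f a != 0.
Proof.
move=> f0 [b /norm_mod_eq]; rewrite norm_modM // norm_mod1 // => /eqP.
by apply: contraTneq => ->; rewrite mul0r eq_sym oner_eq0.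
Qed.

Lemma norm_modZl f a (c : E) : c != 0 -> norm_mod (c *: f) a = norm_mod f a.
Proof.
move=> c0; rewrite /norm_mod size_scale //; congr (\det _).
by apply/matrixP => i j; rewrite !mxE modpZr.
Qed.

(** Reducing the rows X^i f of the Sylvester matrix modulo g is a unipotent row
    operation, after which the matrix is block triangular: one block is
    multiplication by f on E[X]/(g), the other is triangular with lc(g) on the
    diagonal. *)
Lemma resultant_norm f g : f != 0 -> g != 0 ->
  resultant f g = norm_mod g f * lead_coef g ^+ (size f).-1.
Proof.
move=> f0 g0; set n := (size g).-1; set m := (size f).-1.
have Dg : size g = n.+1 by rewrite /n prednK // size_poly_gt0.
have Df : size f = m.+1 by rewrite /m prednK // size_poly_gt0.
pose q (i : 'I_n) := (f * 'X^i) %/ g.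
pose Q : 'M[E]_(n, m) := \matrix_(i, j) (q i)`_j.
pose B : 'M[E]_(m, n) := \matrix_(i, j) (g * 'X^i)`_j.
pose T : 'M[E]_m := \matrix_(i, j) (g * 'X^i)`_(n + j).
pose S' := block_mx (mul_mx g f) (0 : 'M_(n, m)) B T.
have size_q i : (size (q i) <= m)%N.
  rewrite /q size_divp // size_mulXn // Df Dg.
  by case: i => i /= lti; rewrite leq_subLR; lia.
have DS : Sylvester_mx f g = block_mx 1%:M Q 0 1%:M *m S'.
  rewrite mulmx_block !mul1mx !mul0mx !add0r.
  apply/matrixP => i j; rewrite Sylvester_mxE.
  have coefS (r : {poly E}) (k l : nat) : r`_(l - k) *+ (k <= l) =
    (r * 'X^k)`_l.
    by rewrite coefMXn ltnNge; case: leqP.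
  have rowQ (i' : 'I_n) (l : nat) :
      \sum_(k < m) Q i' k * (g * 'X^k)`_l = (q i' * g)`_l.
    transitivity (((\poly_(k < m) (q i')`_k) * g)`_l).
      rewrite poly_def mulr_suml coef_sum; apply: eq_bigr => k _.
      by rewrite mxE -scalerAl coefZ ['X^k * g]mulrC.
    congr ((_ * g : {poly E})`_l); apply/polyP => k; rewrite coef_poly.
    by case: ltnP => // lemk; rewrite nth_default // (leq_trans (size_q _)).
  have modlow (i' : 'I_n) (l : nat) : 
     (f * 'X^i')`_l = ((f * 'X^i') %% g)`_l + (q i' * g)`_l.
    by rewrite -coefD addrC -divp_eq.
  case: (split_ordP i) => i' ->; rewrite /block_mx ?col_mxEu ?col_mxEd;
    case: (split_ordP j) => j' ->; rewrite ?row_mxEl ?row_mxEr coefS /=.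
  - rewrite modlow mxE mxE; congr (_ + _); rewrite -rowQ mxE.
    by apply: eq_bigr => k _; rewrite [B _ _]mxE.
  - rewrite modlow nth_default ?add0r -?rowQ ?mxE.
      by apply: eq_bigr => k _; rewrite [T _ _]mxE.
    by apply: leq_trans (size_modp_deg _ g0) _; apply: leq_addr.
  - by rewrite mxE.
  - by rewrite mxE.
rewrite /resultant DS det_mulmx det_ublock !det1 !mul1r det_lblock.
rewrite norm_modE; congr (_ * _); rewrite det_trig.
  rewrite (eq_bigr (fun=> lead_coef g)) ?prodr_const ?card_ord // => i _.
  by rewrite mxE coefMXn ltnNge leq_addl addnK lead_coefE.
apply/is_trig_mxP => i j ltij; rewrite mxE coefMXn ltnNge.
rewrite (leq_trans (ltnW ltij) (leq_addl _ _)) /= nth_default // Dg.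
by rewrite ltn_subRL addnC ltn_add2l.
Qed.

End NormAlgebra.

Section Reciprocity.

(** The cyclic shift, presented as a lift so that its sign is immediate. *)
Definition rot_perm N : 'S_(N.+1) := lift_perm ord_max ord0 1.

Lemma rot_permX N k (i : 'I_N.+1) :
  ((rot_perm N ^+ k)%g i : nat) = ((i + k) %% N.+1)%N.
Proof.
elim: k => [|k IH]; first by rewrite perm1 addn0 modn_small.
rewrite expgSr permM addnS -[(i + k).+1]addn1 -modnDml -IH.
case: (unliftP ord_max ((rot_perm N ^+ k)%g i)) => [j|] ->.
  by rewrite lift_perm_lift perm1 lift0 lift_max addn1 modn_small // ltnS ltn_ord.
by rewrite lift_perm_id /= addn1 modnn.
Qed.

Lemma odd_rot_permX N k : ((rot_perm N ^+ k)%g : bool) = odd (k * N).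
Proof.
elim: k => [|k IH]; first by rewrite odd_perm1.
rewrite expgS odd_permM IH odd_lift_perm odd_perm1 /= !addbF mulSn oddD.
by [].
Qed.

Lemma det_rot_rows (R : comNzRingType) N k (A B : 'M[R]_N) :
    (forall i i' j : 'I_N, i' = ((i + k) %% N)%N :> nat -> B i j = A i' j) ->
  \det B = (-1) ^+ (k * N.-1) * \det A.
Proof.
case: N A B => [|N] A B rotAB; first by rewrite !det_mx00 muln0 mulr1.
have -> : B = row_perm (rot_perm N ^+ k)%g A.
  by apply/matrixP => i j; rewrite mxE; apply: rotAB; rewrite rot_permX.
by rewrite row_permE det_mulmx det_perm odd_rot_permX signr_odd.
Qed.

Lemma det_castmx (R : comNzRingType) m n (e : m = n) (A : 'M[R]_m) :
  \det (castmx (e, e) A) = \det A.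
Proof. by case: n / e; rewrite castmx_id. Qed.

Variable E : fieldType.
Implicit Types f g : {poly E}.

Lemma Sylvester_mx_nat f g i j :
  Sylvester_mx f g i j =
    (if (i < (size g).-1)%N then f * 'X^i else g * 'X^(i - (size g).-1))`_j.
Proof.
have coefS (r : {poly E}) (k l : nat) : r`_(l - k) *+ (k <= l) = (r * 'X^k)`_l.
  by rewrite coefMXn ltnNge; case: leqP.
rewrite Sylvester_mxE; case: (split_ordP i) => i' ->; rewrite coefS //=.
by rewrite addKn.
Qed.

(** The two Sylvester matrices differ by a cyclic shift of the rows. *)
Lemma resultantC f g :
  resultant g f = (-1) ^+ ((size f).-1 * (size g).-1) * resultant f g.
Proof.
set m := (size f).-1; set n := (size g).-1.
have -> : resultant g f = (-1) ^+ (n * (n + m).-1) * resultant f g.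
  rewrite -[resultant g f](det_castmx (addnC m n));
    apply: det_rot_rows => i i' j Di'.
  rewrite castmxE !Sylvester_mx_nat /= -/m -/n Di'.
  have i_lt : (i < n + m)%N := ltn_ord i.
  case: ltnP => im.
    rewrite modn_small; last by rewrite addnC ltn_add2l.
    by rewrite ltnNge leq_addl addnK.
  have -> : ((i + n) %% (n + m) = i - m)%N.
    rewrite -{1}(subnK im) -addnA [(m + n)%N]addnC modnDr modn_small //.
    by rewrite ltn_subLR // (leq_trans i_lt)
      // [leqLHS]addnC leq_add2l leq_addr.
  by rewrite ltn_subLR // (leq_trans i_lt) // addnC.
rewrite -signr_odd -[in RHS]signr_odd; congr ((-1) ^+ _ * _); congr nat_of_bool.
case: n => [|n]; first by rewrite muln0.
by rewrite addSn /= !oddM oddD /=; case: (odd n); case: (odd m).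
Qed.

(** Both norms are resultants up to powers of leading coefficients. *)
Lemma norm_reciprocity f g : f != 0 -> g != 0 ->
  norm_mod f g * lead_coef f ^+ (size g).-1 =
    (-1) ^+ ((size f).-1 * (size g).-1) *
      (norm_mod g f * lead_coef g ^+ (size f).-1).
Proof. by move=> f0 g0; rewrite -!resultant_norm // resultantC. Qed.

End Reciprocity.

(** * Ternary forms over the residue fields *)

Section ResidueForms.

Variable E : fieldType.

Lemma diag_regular (F : fieldType) n (a : 'rV[F]_n) :
  (forall i, a 0 i != 0) -> regular_form (diag_mx a).
Proof.
move=> a0; split; first by rewrite tr_diag_mx.
by rewrite unitmxE det_diag unitfE; apply/prodf_neq0.
Qed.

(** The residue field E[X]/(p) is a finite extension of E, over which every
    regular ternary form is isotropic by the bound on u. *)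
Lemma residue_ternary (p : {poly E}) (b : 'I_3 -> {poly E}) :
    (forall E' : fieldExtType E, u_le E' 2) -> irreducible_poly p ->
    (forall i, ~~ (p %| b i)) ->
  exists x : 'I_3 -> {poly E},
    (exists i, ~~ (p %| x i)) /\ p %| \sum_i b i * x i ^+ 2.
Proof.
move=> uE p_irr pNb; have [L _ [z pz0 Lz]] := irredp_FAdjoin p_irr.
pose ev (q : {poly E}) := (map_poly (in_alg L) q).[z].
have evM q r : ev (q * r) = ev q * ev r by rewrite /ev rmorphM hornerM.
have ev_eq0 q : (ev q == 0) = (p %| q).
  apply/idP/idP => [q0|/dvdpP [r ->]];
    last by rewrite evM [ev p](rootP pz0) mulr0.
  apply/negPn; apply: contraTN q0; rewrite -irreducible_poly_coprime //.
  case/Bezout_eq1_coprimepP => -[k l] /= Dkl.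
  have : ev (k * p + l * q) = 1 by rewrite Dkl /ev rmorph1 hornerC.
  rewrite /ev rmorphD hornerD -!/(ev _) !evM [ev p](rootP pz0) mulr0 add0r =>
    Dlq.
  by apply: contra_eq_neq Dlq => ->; rewrite mulr0 eq_sym oner_eq0.
have ev_surj (y : L) : exists q, ev q = y.
  have : y \in <<1; z>>%VS by rewrite Lz memvf.
  by case/Fadjoin_polyP => _ /polyOver1P [q ->] ->; exists q.
pose A : 'M[L]_3 := diag_mx (\row_i ev (b i)).
have A_reg : regular_form A by apply: diag_regular => i; rewrite mxE ev_eq0.
have A_iso : isotropic A.
  by apply: NNPP => A_aniso; have := uE L 3%N A A_reg A_aniso.
case: A_iso => y y0; rewrite qform_diag => Dy.
have [x Dx] := fin_all_exists (fun i => ev_surj (y 0 i)).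
exists x; split.
  apply: NNPP => px; case/eqP: y0; apply/rowP => i; rewrite mxE -Dx.
  by apply/eqP; rewrite ev_eq0; apply/negPn/negP => pNx; apply: px; exists i.
rewrite -ev_eq0 /ev rmorph_sum horner_sum; apply/eqP.
rewrite -[RHS]Dy; apply: eq_bigr => i _.
by rewrite -/(ev _) !evM Dx mxE -expr2.
Qed.

End ResidueForms.

(** * Isotropy over a completion *)

Section Valuations.

Variables (K : fieldType) (w : K -> int).
Hypothesis wV : Zvaluation w.
Implicit Types (x y : K) (j k : int).

Let wM x y : x != 0 -> y != 0 -> w (x * y) = w x + w y.
Proof. by case: wV => + _ _; apply. Qed.

Lemma val1 : w 1 = 0.
Proof. by have := wM (oner_neq0 K) (oner_neq0 K); rewrite mulr1;
  move: (w 1) => k; lia. Qed.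

Lemma valN x : x != 0 -> w (- x) = w x.
Proof.
have N1 : -1 != 0 :> K by rewrite oppr_eq0 oner_neq0.
have wN1 : w (-1) = 0 by have := wM N1 N1; rewrite mulrNN mulr1 val1;
  move: (w (-1)) => k; lia.
by move=> x0; rewrite -mulN1r wM // wN1 add0r.
Qed.

Lemma valV x : x != 0 -> w x^-1 = - w x.
Proof.
move=> x0; have := wM x0 (invr_neq0 x0); rewrite divff // val1.
by move: (w x) (w x^-1) => j k; lia.
Qed.

Lemma val_geW j k x : j <= k -> val_ge w k x -> val_ge w j x.
Proof. by move=> jk [->|kx]; [left | right; apply: le_trans kx]. Qed.

Lemma val_geD k x y : val_ge w k x -> val_ge w k y -> val_ge w k (x + y).
Proof.
move=> [->|kx]; first by rewrite add0r.
move=> [->|ky]; first by rewrite addr0; right.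
have [->|x0] := eqVneq x 0; first by rewrite add0r; right.
have [->|y0] := eqVneq y 0; first by rewrite addr0; right.
have [xy|xy0] := eqVneq (x + y) 0; [by left | right].
case: wV => _ wD _; apply: le_trans (wD x y x0 y0 xy0).
by rewrite le_min kx ky.
Qed.

Lemma val_geN k x : val_ge w k x -> val_ge w k (- x).
Proof.
move=> [->|kx]; first by rewrite oppr0; left.
have [->|x0] := eqVneq x 0; first by rewrite oppr0; left.
by right; rewrite valN.
Qed.

Lemma val_geB k x y : val_ge w k x -> val_ge w k y -> val_ge w k (x - y).
Proof. by move=> kx /val_geN; apply: val_geD. Qed.

Lemma val_geM j k x y : val_ge w j x -> val_ge w k y -> val_ge w (j + k)
  (x * y).
Proof.
move=> [->|jx]; first by rewrite mul0r; left.
move=> [->|ky]; first by rewrite mulr0; left.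
have [->|x0] := eqVneq x 0; first by rewrite mul0r; left.
have [->|y0] := eqVneq y 0; first by rewrite mulr0; left.
by right; rewrite wM // lerD.
Qed.

Lemma val_ge_all0 x : (forall n : nat, val_ge w n%:Z x) -> x = 0.
Proof.
move=> xge; have := xge `|w x|.+1%N; case=> //; lia.
Qed.

Section Hensel.

Hypotheses (two0 : 2 != 0 :> K) (w2 : w 2 = 0).
Hypothesis w_complete :
  forall u : nat -> K, val_cauchy w u -> exists l, val_converges w u l.

Variable u : K.
Hypothesis u1 : val_ge w 1 (u - 1).

(** The slope 2 y of y ^ 2 - u is congruent to 2 for all y congruent to 1, so
    that Newton's iteration with the slope frozen at 2 gains one digit at each
    step. *)
Definition sqrt_approx n := iter n (fun y => y - (y ^+ 2 - u) / 2) 1.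

Lemma sqrt_approxP n :
  val_ge w 1 (sqrt_approx n - 1) /\ val_ge w n.+1%:Z (sqrt_approx n ^+ 2 - u).
Proof.
have half_ge0 : val_ge w 0 2^-1 by right; rewrite valV // w2.
elim: n => [|n [y1 yu]].
  split; first by left; rewrite subrr.
  by rewrite /= expr1n -opprB; apply: val_geN.
rewrite /sqrt_approx iterS -/(sqrt_approx n); set y := sqrt_approx n in y1 yu *.
set d := y ^+ 2 - u in yu *.
have d2 : val_ge w n.+1%:Z (d / 2) by rewrite -[n.+1%:Z]addr0; apply: val_geM.
have d2_1 : val_ge w 1 (d / 2) by apply: val_geW d2; lia.
split; first by rewrite addrAC; apply: val_geB.
have -> : (y - d / 2) ^+ 2 - u = d * ((d / 2) * 2^-1 - (y - 1)).
  by rewrite /d; field.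
have -> : n.+2%:Z = n.+1%:Z + 1 by lia.
apply: val_geM => //; apply: val_geB => //.
by rewrite -[1]addr0; apply: val_geM.
Qed.

Lemma sqrt_approx_step n m :
  val_ge w n.+1%:Z (sqrt_approx (n + m) - sqrt_approx n).
Proof.
elim: m => [|m IH]; first by rewrite addn0 subrr; left.
rewrite addnS {1}/sqrt_approx iterS -/(sqrt_approx _) addrAC;
  apply: val_geB => //.
rewrite -[n.+1%:Z]addr0; apply: val_geM; last by right; rewrite valV // w2.
by apply: val_geW (sqrt_approxP _).2; rewrite lez_nat ltnS leq_addr.
Qed.

Lemma one_unit_square : exists t, t ^+ 2 = u.
Proof.
have [|l yl] := w_complete (u := sqrt_approx).
  move=> k; exists `|k|%N => m n km kn.
  have step i : (`|k| <= i)%N -> val_ge w k (sqrt_approx i - sqrt_approx `|k|).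
    by move=> ki; rewrite -(subnKC ki); apply: val_geW (sqrt_approx_step _ _);
      lia.
  rewrite -(subrKA (sqrt_approx `|k|)) -[sqrt_approx `|k| - _]opprB.
  by apply: val_geB; apply: step.
exists l; apply/eqP; rewrite -subr_eq0; apply/eqP/val_ge_all0 => m.
have [N yN] := yl m%:Z; set n := maxn N m.
have {yN} yn := yN n (leq_maxl _ _); have [y1 yu] := sqrt_approxP n.
set y := sqrt_approx n in yn y1 yu.
have m0 : (0 : int) <= m%:Z by [].
have y_ge0 : val_ge w 0 y.
  by rewrite -(subrK 1 y); apply: val_geD; [apply: val_geW y1 | right;
    rewrite val1].
have -> : l ^+ 2 - u = (y ^+ 2 - u) - (y - l) * (y + y - (y - l)) by ring.
apply: val_geB; first by apply: val_geW yu; rewrite lez_nat leqW // leq_maxr.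
rewrite -[m%:Z]addr0; apply: val_geM => //.
by apply: val_geB; [apply: val_geD | apply: val_geW yn].
Qed.

End Hensel.

End Valuations.

(** If the sum is smaller than its j-th term, then minus the other terms is
    that term times a 1-unit, whose square root corrects the j-th coordinate.
    *)
Lemma approximate_zero_isotropic (K : fieldType) (v : K -> int) n
    (a x : 'rV[K]_n) (j : 'I_n) :
    2 != 0 :> K -> v 2 = 0 -> a 0 j != 0 -> x 0 j != 0 ->
    val_ge v (v (a 0 j * x 0 j ^+ 2) + 1) (\sum_i a 0 i * x 0 i ^+ 2) ->
  Zvaluation v -> isotropic_over_completion v (diag_mx a).
Proof.
move=> two0 v2 a0 x0 Sge vV L iota w [wV wv w_complete _].
set S := \sum_i _ in Sge; set c := a 0 j * x 0 j ^+ 2 in Sge.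
have c0 : c != 0 by rewrite mulf_neq0 // expf_neq0.
have iota2 : iota 2 = 2 by rewrite rmorph_nat.
have e_ge1 : val_ge w 1 (iota (S / c)).
  have [S0|S0] := eqVneq S 0; first by left; rewrite S0 mul0r rmorph0.
  right; rewrite wv ?mulf_neq0 ?invr_neq0 //.
  case: Sge => [/eqP|]; first by rewrite (negPf S0).
  case: (vV) => vM _ _; rewrite vM ?invr_neq0 // valV //; lia.
have [|||t Dt] := @one_unit_square L w wV _ _ w_complete (1 - iota (S / c)).
- by rewrite -iota2 fmorph_eq0.
- by rewrite -iota2 wv.
- by rewrite addrAC subrr add0r; apply: val_geN.
have t0 : t != 0.
  apply: contraTneq isT => t0; move/eqP: Dt.
  rewrite t0 expr0n /= eq_sym subr_eq0 => /eqP e1.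
  by move: e_ge1; rewrite -e1 => -[/eqP|]; rewrite ?oner_eq0 ?val1.
exists (\row_i (iota (x 0 i) * (if i == j then t else 1))).
  apply/eqP => /rowP /(_ j) /eqP.
  by rewrite !mxE eqxx mulf_eq0 fmorph_eq0 (negPf x0) (negPf t0).
rewrite map_diag_mx qform_diag (bigD1 j) //=.
rewrite (eq_bigr (fun i => iota (a 0 i * x 0 i ^+ 2))) => [|i /negPf ij];
  last first.
  by rewrite !mxE ij mulr1 rmorphM rmorphXn.
rewrite !mxE eqxx exprMn Dt mulrA -rmorphXn -rmorphM -/c mulrBr mulr1 -rmorphM.
by rewrite mulrCA divff // mulr1 /S (bigD1 j)
  //= -/c rmorphD rmorph_sum opprD addNKr addNr.
Qed.

(** * The places of a rational function field *)

Section Fractions.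

Import FracField.

Lemma fraction_numden (R : idomainType) (x : {fraction R}) :
  exists c : R * R, c.2 != 0 /\ tofrac c.2 * x = tofrac c.1.
Proof.
elim/quotW: x => r; exists (\n_r, \d_r); split; first exact: denom_ratioP.
rewrite /=; unlock tofrac; rewrite -[LHS]pi_mul.
apply/eqmodP; rewrite /= equivfE /mulf /= !numden_Ratio ?oner_neq0 ?mul1r
  ?denom_ratioP //.
by rewrite mulr1 mulrC.
Qed.

End Fractions.

Lemma clear_denominators (R : idomainType) n (x : 'rV[{fraction R}]_n) :
  exists2 c : R, c != 0 & exists y : 'I_n -> R, forall i, tofrac c * x 0 i =
    tofrac (y i).
Proof.
have [d Dd] := fin_all_exists (fun i => fraction_numden (x 0 i)).
exists (\prod_i (d i).2); first by apply/prodf_neq0 => i _; case: (Dd i).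
exists (fun i => (\prod_(k | k != i) (d k).2) * (d i).1) => i.
by rewrite (bigD1 i) //= !tofracM mulrAC; case: (Dd i) => _ ->; rewrite mulrC.
Qed.

Section Places.

Variables (E : fieldType) (v : ratfun E -> int).
Hypothesis (vO : Omega v).
Hypothesis two0 : 2 != 0 :> E.
Implicit Types a b p q : {poly E}.

Local Notation V a := (v (tofrac a)).
Local Notation "x %:F" := (tofrac x).

Let vV : Zvaluation v. Proof. by case: vO. Qed.

Let F0 a : (a%:F == 0) = (a == 0).
Proof. exact: tofrac_eq0. Qed.

Lemma placeM a b : a != 0 -> b != 0 -> V (a * b) = V a + V b.
Proof. by move=> a0 b0; rewrite tofracM; case: vV => + _ _; apply;
  rewrite F0. Qed.

Lemma place_const_ge0 (c : E) : val_ge v 0 (tofrac c%:P).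
Proof.
have [->|c0] := eqVneq c 0; first by left; rewrite tofrac0.
by right; case: vO => _ ->.
Qed.

Lemma place_two0 : 2 != 0 :> ratfun E.
Proof. by rewrite -(rmorph_nat (@tofrac {poly E}))
  F0 -polyC_natr polyC_eq0. Qed.

Lemma place_two : v 2 = 0.
Proof. by rewrite -(rmorph_nat (@tofrac {poly E})) -polyC_natr;
  case: vO => _ ->. Qed.

Section Finite.

Hypothesis vX : 0 <= V 'X.

Lemma finite_place_ge0 a : val_ge v 0 a%:F.
Proof.
elim/poly_ind: a => [|a c IH]; first by left; rewrite tofrac0.
rewrite tofracD tofracM; apply: val_geD => //; last exact: place_const_ge0.
by rewrite -[0]addr0; apply: val_geM => //; right.
Qed.

(** Some polynomial has positive value, as the value group is not trivial, and
    then so has one of its irreducible factors. *)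
Lemma finite_place_prime : exists2 p, irreducible_poly p & 0 < V p.
Proof.
have [x x0 vx] : exists2 x, x != 0 & v x = 1 by case: vV => _ _; apply.
have [[a b] /= [b0 Dab]] := fraction_numden x.
have a0 : a != 0 by rewrite -F0 -Dab mulf_neq0 ?F0.
have Va : 0 < V a.
  rewrite -Dab; case: vV => vM _ _; rewrite vM ?F0 // vx.
  case: (finite_place_ge0 b) => [/eqP|]; first by rewrite F0 (negPf b0).
  by move: (V b) => k; lia.
move: a a0 Va {Dab}; apply: irred_ind => [c c1|p q p_irr q0 IH].
  have /size_poly1P [k k0 ->] : size c == 1%N by rewrite c1.
  by case: vO => _ ->.
rewrite placeM ?(irredp_neq0 p_irr) // => Vpq.
have [Vp|Vp] := ltP 0 (V p); first by exists p.
by apply: IH; move: (V p) (V q) Vp Vpq => j k; lia.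
Qed.

Lemma finite_place_isotropic n (b : 'I_n -> {poly E}) :
    (forall p, irreducible_poly p -> exists x : 'I_n -> {poly E},
       (exists j, ~~ (p %| b j * x j)) /\ p %| \sum_i b i * x i ^+ 2) ->
  isotropic_over_completion v (diag_mx (\row_i (b i)%:F)).
Proof.
move=> loc; have [p p_irr Vp] := finite_place_prime.
have p0 := irredp_neq0 p_irr.
have ge_p a : p %| a -> val_ge v 1 a%:F.
  case/dvdpP => c ->; rewrite tofracM -[1]add0r; apply: val_geM => //.
    exact: finite_place_ge0.
  by right; move: (V p) Vp => k; lia.
have unit_p a : ~~ (p %| a) -> V a = 0.
  move=> pNa; have a0 : a != 0 by apply: contraNneq pNa => ->; rewrite dvdp0.
  have := pNa; rewrite -irreducible_poly_coprime // =>
    /Bezout_eq1_coprimepP [[k l] /= Dkl].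
  case: (finite_place_ge0 a) => [/eqP|Va]; first by rewrite F0 (negPf a0).
  apply/eqP; rewrite eq_le Va andbT leNgt; apply/negP => Va_gt0.
  have : val_ge v 1 1%:F.
    rewrite -Dkl tofracD; apply: val_geD => //; first by apply: ge_p;
      apply: dvdp_mull.
    rewrite tofracM -[1]add0r; apply: val_geM => //;
      first exact: finite_place_ge0.
    by right; move: (V a) Va_gt0 => m; lia.
  by rewrite tofrac1 => -[/eqP|]; rewrite ?oner_eq0 ?val1.
have [x [[j]]] := loc p p_irr;
  rewrite irred_dvdpM // negb_or => /andP [pNb pNx] px.
have bj0 : b j != 0 by apply: contraNneq pNb => ->; rewrite dvdp0.
have xj0 : x j != 0 by apply: contraNneq pNx => ->; rewrite dvdp0.
apply: (@approximate_zero_isotropic _ v n _ (\row_i (x i)%:F) j) => //.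
- exact: place_two0.
- exact: place_two.
- by rewrite mxE F0.
- by rewrite mxE F0.
rewrite !mxE -tofracXn -tofracM unit_p; last first.
  by rewrite irred_dvdpM // irred_dvdpX2 // negb_or pNb.
rewrite add0r (eq_bigr (fun i => (b i * x i ^+ 2)%:F)) => [|i _].
  by rewrite -rmorph_sum; apply: ge_p.
by rewrite !mxE tofracM tofracXn.
Qed.

End Finite.

Section Infinite.

Hypothesis vX : V 'X < 0.

Lemma infinite_place_ge n a : (size a <= n.+1)%N -> val_ge v (V 'X * n%:Z) a%:F.
Proof.
elim: n a => [|n IH] a.
  by move=> /size1_polyC ->; rewrite mulr0; apply: place_const_ge0.
elim/poly_ind: a => [|a c _]; first by left; rewrite tofrac0.
rewrite size_MXaddC => a_le; rewrite tofracD tofracM; apply: val_geD => //.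
  have a_le' : (size a <= n.+1)%N.
    by move: a_le; case: ifP => // /andP [/eqP -> _]; rewrite size_poly0.
  rewrite -addn1 PoszD mulrDr mulr1; apply: val_geM => //; first exact: IH.
  by right.
apply: val_geW (place_const_ge0 c).
by move: (V 'X) vX => k; nia.
Qed.

Lemma infinite_place_size a n : size a = n.+1 -> V a = V 'X * n%:Z.
Proof.
move=> Da; have a0 : a != 0 by rewrite -size_poly_eq0 Da.
have X0 : 'X != 0 :> {poly E} by rewrite polyX_eq0.
have VXn m : V 'X^m = V 'X * m%:Z.
  elim: m => [|m IH]; first by rewrite expr0 tofrac1 val1 // mulr0.
  rewrite exprS placeM ?expf_neq0 // IH; move: (V 'X) => k; lia.
have lc0 : lead_coef a != 0 by rewrite lead_coef_eq0.
pose r := a - lead_coef a *: 'X^n.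
have r_le : (size r <= n)%N.
  apply/leq_sizeP => i; rewrite leq_eqVlt => /predU1P [<-|ni].
    by rewrite coefB coefZ coefXn eqxx mulr1 lead_coefE Da subrr.
  by rewrite coefB coefZ coefXn gtn_eqF // mulr0 subr0 nth_default // Da.
have Vlc : V (lead_coef a *: 'X^n) = V 'X * n%:Z.
  rewrite -mul_polyC placeM ?polyC_eq0 ?expf_neq0 // VXn.
  by case: vO => _ ->; rewrite // add0r.
have [] : val_ge v (V 'X * n%:Z) a%:F by apply: infinite_place_ge; rewrite Da.
  by move/eqP; rewrite F0 (negPf a0).
rewrite le_eqVlt => /predU1P [-> //|Va_gt].
have r_ge : val_ge v (V 'X * n%:Z + 1) r%:F.
  move: r_le; case: (n) => [|m] r_le.
    by left; move: r_le; rewrite leqn0 size_poly_eq0 => /eqP ->;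
      rewrite tofrac0.
  apply: val_geW (infinite_place_ge r_le).
  by move: (V 'X) vX => k; lia.
have : val_ge v (V 'X * n%:Z + 1) (lead_coef a *: 'X^n)%:F.
  have -> : lead_coef a *: 'X^n = a - r by rewrite /r subKr.
  rewrite tofracB; apply: val_geB => //; right.
  by move: (V a) Va_gt => k; lia.
case=> [/eqP|]; first by rewrite F0 scaler_eq0 (negPf lc0) expf_eq0 (negPf X0)
  andbF.
by rewrite Vlc; move: (V 'X) => k; lia.
Qed.

(** Multiplying the coordinates by powers of X gives all selected terms the
    same degree; the hypothesis says that the coefficients in that degree
    cancel. *)
Lemma infinite_place_isotropic n (b : 'I_n -> {poly E}) (xi : 'I_n -> E)
  (e : bool) :
    (forall i, b i != 0) -> (exists j, xi j != 0) ->
    (forall i, xi i != 0 -> odd (size (b i)) = e) ->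
    \sum_i lead_coef (b i) * xi i ^+ 2 = 0 ->
  isotropic_over_completion v (diag_mx (\row_i (b i)%:F)).
Proof.
move=> b0 [j xij] parity sum0.
(* T is the common size of the selected terms: large, of the right parity. *)
pose T := (e + (\sum_i size (b i)).*2)%N.
have T_ge i : (size (b i) <= T)%N.
  by rewrite /T -addnn (bigD1 i) //=; lia.
pose k i := (T - size (b i))./2.
have Dk i : xi i != 0 -> ((k i).*2 + size (b i) = T)%N.
  move=> /parity be; rewrite /k -[RHS](subnK (T_ge i)); congr (_ + _)%N.
  rewrite -[RHS]odd_double_half oddB // /T oddD odd_double be addbF.
  by rewrite oddb addbb.
pose x i := xi i *: 'X^(k i).
have Dterm i : b i * x i ^+ 2 = xi i ^+ 2 *: (b i * 'X^((k i).*2)).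
  by rewrite /x exprZn -scalerAr -exprM muln2.
have size_term i : (size (b i * x i ^+ 2)%R <= T)%N.
  rewrite Dterm; have [->|xi0] := eqVneq (xi i) 0.
    by rewrite expr0n scale0r size_poly0.
  by rewrite size_scale ?expf_neq0 // size_mulXn // Dk.
have T_gt0 : (0 < T)%N by apply: leq_trans (T_ge j); rewrite size_poly_gt0.
have size_sum : (size (\sum_i b i * x i ^+ 2)%R <= T.-1)%N.
  apply/leq_sizeP => m Tm; rewrite coef_sum.
  have [mT|Tm'] := eqVneq m T.-1; last first.
    apply: big1 => i _; rewrite nth_default // (leq_trans (size_term i)) //.
    by rewrite -(prednK T_gt0) ltn_neqAle eq_sym Tm' Tm.
  rewrite -[RHS]sum0; apply: eq_bigr => i _; rewrite Dterm coefZ mulrC.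
  have [->|xi0] := eqVneq (xi i) 0; first by rewrite expr0n !mulr0.
  rewrite coefMXn mT lead_coefE -(Dk i xi0) ltnNge.
  have : (0 < size (b i))%N by rewrite size_poly_gt0.
  case: (size (b i)) => // s _; rewrite addnS /= leq_addr /=.
  by rewrite addKn.
have size_j : size (b j * x j ^+ 2) = T.
  by rewrite Dterm size_scale ?expf_neq0 // size_mulXn // Dk.
have xj0 : x j != 0 by rewrite scaler_eq0 negb_or xij expf_eq0 polyX_eq0 andbF.
apply: (@approximate_zero_isotropic _ v n _ (\row_i (x i)%:F) j) => //.
- exact: place_two0.
- exact: place_two.
- by rewrite mxE F0.
- by rewrite mxE F0.
rewrite !mxE -tofracXn -tofracM (@infinite_place_size _ T.-1) ?size_j
  ?prednK //.
rewrite (eq_bigr (fun i => (b i * x i ^+ 2)%:F)) => [|i _]; last first.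
  by rewrite !mxE tofracM tofracXn.
rewrite -rmorph_sum; case: (T.-1) size_sum => [|m] size_sum.
  by left; move: size_sum; rewrite leqn0 size_poly_eq0 => /eqP ->;
    rewrite rmorph0.
apply: val_geW (infinite_place_ge size_sum).
by move: (V 'X) vX => l; lia.
Qed.

End Infinite.

End Places.

(** * Isotropy at infinity *)

(** E is the residue field of the place X = 0. *)
Lemma ternary_zero (E : fieldType) (b : 'I_3 -> E) :
    (forall E' : fieldExtType E, u_le E' 2) -> (forall i, b i != 0) ->
  exists x : 'I_3 -> E, (exists i, x i != 0) /\ \sum_i b i * x i ^+ 2 = 0.
Proof.
move=> uE b0; have X_irr : irreducible_poly ('X : {poly E}).
  by rewrite -['X]subr0; apply: irredp_XsubC.
have X_dvd (q : {poly E}) : ('X %| q) = (q.[0] == 0).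
  by rewrite -['X]subr0 dvdp_XsubCl.
have [|x [[i xi] sum0]] := @residue_ternary E 'X (fun i => (b i)%:P) uE X_irr.
  by move=> i; rewrite X_dvd hornerC.
exists (fun i => (x i).[0]); split; first by exists i; rewrite -X_dvd.
move: sum0; rewrite X_dvd horner_sum => /eqP sum0; rewrite -[RHS]sum0.
by apply: eq_bigr => k _; rewrite hornerM hornerC horner_exp.
Qed.

Definition form_coefs (E : fieldType) (f g h : {poly E}) (i : 'I_4)
  : {poly E} :=
  [:: 1; - (h * f); - g; h * g]`_i.

Lemma sum_ord4 (R : pzRingType) (b x : 'I_4 -> R) :
  \sum_i b i * x i ^+ 2 = b (inord 0) * x (inord 0) ^+ 2 + b (inord 1) * x
    (inord 1) ^+ 2
   + b (inord 2) * x (inord 2) ^+ 2 + b (inord 3) * x (inord 3) ^+ 2.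
Proof.
have E4 (k : nat) (i : 'I_4) : i = k :> nat -> i = inord k.
  by move=> <-; rewrite inord_val.
rewrite !big_ord_recl big_ord0 addr0 !addrA.
by congr (b _ * x _ ^+ 2 + b _ * x _ ^+ 2 + b _ * x _ ^+ 2 + b _ * x _ ^+ 2);
  apply: E4.
Qed.

Section NormClass.

Variables (E : fieldType) (f g h k k' : {poly E}).
Hypotheses (f0 : f != 0) (g0 : g != 0) (h0 : h != 0).
Hypotheses (fg : unit_mod g f) (k_unit : unit_mod g k)
  (k'_unit : unit_mod h k').
Hypotheses (hfk : eq_mod g h (f * k ^+ 2)) (gk : eq_mod h g (1 * k' ^+ 2)).
Hypothesis f_even : ~~ odd (size f).-1.

Lemma expr_parity (x : E) n : x ^+ n = x ^+ odd n * (x ^+ n./2) ^+ 2.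
Proof. by rewrite -exprM muln2 -exprD odd_double_half. Qed.

(** Reciprocity for the pairs (g, f) and (g, h): the norms of f and h modulo g
    agree up to squares and the norm of g modulo h is a square, so that only
    leading coefficients remain. *)
Lemma norm_class_at_infinity :
  exists2 t : E, t != 0 &
    norm_mod f g = (-1) ^+ (odd (size g).-1 && odd (size h).-1)
      * lead_coef g ^+ odd (size h).-1
      * (lead_coef h * lead_coef f) ^+ odd (size g).-1 * t ^+ 2.
Proof.
set m := (size g).-1; set n := (size h).-1.
set lf := lead_coef f; set lg := lead_coef g; set lh := lead_coef h.
have lf0 : lf != 0 by rewrite lead_coef_eq0.
have lg0 : lg != 0 by rewrite lead_coef_eq0.
have lh0 : lh != 0 by rewrite lead_coef_eq0.
have Rf := norm_reciprocity g0 f0; have Rh := norm_reciprocity g0 h0.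
rewrite -/m -/n -/lf -/lg -/lh in Rf Rh.
have c0 := norm_mod_neq0 g0 fg; have d0 := norm_mod_neq0 g0 k_unit.
have d'0 := norm_mod_neq0 h0 k'_unit.
rewrite (norm_mod_eq hfk) (norm_mod_eq gk) mul1r norm_modM // !norm_modX2 //
  in Rh.
move: f_even Rf; set F := (size f).-1 => F_even Rf.
rewrite -signr_odd oddM (negPf F_even) andbF mul1r in Rf.
move: (norm_mod f g) (norm_mod g f) (norm_mod g k) (norm_mod h k')
  c0 d0 d'0 Rf Rh.
move=> N c d d' c0 d0 d'0 Rf Rh.
pose u := lh * lf; have u0 : u != 0 by rewrite mulf_neq0.
exists (c * d * lg ^+ F./2 * lg ^+ n./2 / (u ^+ odd m * d' * u ^+ m./2)).
  by rewrite !(mulf_neq0, invr_neq0, expf_neq0).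
rewrite -/u.
have DF : lg ^+ F = (lg ^+ F./2) ^+ 2 by rewrite expr_parity (negPf F_even)
  mul1r.
have Dn := expr_parity lg n; have Dm := expr_parity u m.
have RfRh : (c * lg ^+ F) * (c * d ^+ 2 * lg ^+ n) = (-1) ^+ (m * n)
  * N * u ^+ m * d' ^+ 2.
  by rewrite Rf Rh /u exprMn; ring.
rewrite DF Dn Dm in RfRh.
(* The signs enter only through the square of e below. *)
have S2 : ((-1) ^+ (odd m && odd n) : E) ^+ 2 = 1 by rewrite sqrr_sign.
rewrite -signr_odd oddM in RfRh; move: S2 RfRh.
have v0 : u ^+ odd m != 0 by rewrite expf_neq0.
have w0 : u ^+ m./2 != 0 by rewrite expf_neq0.
move: (_ ^+ (odd m && odd n)) (u ^+ odd m) (u ^+ m./2) (lg ^+ F./2)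
  (lg ^+ n./2) (lg ^+ odd n) v0 w0.
move=> e v w x y z v0 w0 e2 RfRh; rewrite -[N]mul1r -e2.
apply: (mulIf v0); apply: (mulIf (expf_neq0 2 w0));
  apply: (mulIf (expf_neq0 2 d'0)).
transitivity (e * (e * N * (v * w ^+ 2) * d' ^+ 2)); first by ring.
by rewrite -RfRh; field; rewrite v0 w0 d'0.
Qed.

End NormClass.

Section AtInfinity.

Variables (E : fieldType) (f g h : {poly E}) (v : ratfun E -> int).
Hypotheses (two0 : 2 != 0 :> E) (uE : forall E' : fieldExtType E, u_le E' 2).
Hypotheses (vO : Omega v) (vX : v (tofrac 'X) < 0).
Hypotheses (f0 : f != 0) (g0 : g != 0) (h0 : h != 0).

Let lf0 : lead_coef f != 0. Proof. by rewrite lead_coef_eq0. Qed.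
Let lg0 : lead_coef g != 0. Proof. by rewrite lead_coef_eq0. Qed.
Let lh0 : lead_coef h != 0. Proof. by rewrite lead_coef_eq0. Qed.

Lemma form_coefs_neq0 i : form_coefs f g h i != 0.
Proof.
by case: i => -[|[|[|[|i]]]] //= lti;
  rewrite /form_coefs /= ?oppr_eq0 ?mulf_neq0 ?oner_neq0.
Qed.

Let odd_size (a : {poly E}) : a != 0 -> odd (size a) = ~~ odd (size a).-1.
Proof. by rewrite -size_poly_gt0; case: (size a). Qed.

Let degM (a b : {poly E}) : a != 0 -> b != 0 ->
  (size (a * b)%R).-1 = ((size a).-1 + (size b).-1)%N.
Proof.
move=> a0 b0; rewrite size_mul //; rewrite -!size_poly_gt0 in a0 b0.
by move: a0 b0; case: (size a) => // k _; case: (size b) => // l _;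
  rewrite addSn addnS.
Qed.

(** Here e tells whether the selected entries have even degree; their leading
    coefficients form the residue form. *)
Lemma isotropic_at_infinity_of_zero (x0 x1 x2 x3 : E) (e : bool) :
    [|| x0 != 0, x1 != 0, x2 != 0 | x3 != 0] ->
    x0 ^+ 2 - lead_coef h * lead_coef f * x1 ^+ 2 - lead_coef g * x2 ^+ 2
      + lead_coef h * lead_coef g * x3 ^+ 2 = 0 ->
    [&& (x0 == 0) || e,
        (x1 == 0) || (odd (size h).-1 (+) odd (size f).-1 (+) e),
        (x2 == 0) || (odd (size g).-1 (+) e)
      & (x3 == 0) || (odd (size h).-1 (+) odd (size g).-1 (+) e)] ->
  isotropic_over_completion v (diag_mx (\row_i tofrac (form_coefs f g h i))).
Proof.
move=> nz sum0 /and4P [e0 e1 e2 e3].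
have hf0 : h * f != 0 by rewrite mulf_neq0.
have hg0 : h * g != 0 by rewrite mulf_neq0.
apply: (@infinite_place_isotropic E v vO two0 vX 4 _
  (fun i : 'I_4 => [:: x0; x1; x2; x3]`_i) e).
- exact: form_coefs_neq0.
- by case/or4P: nz => xi; [exists (inord 0) | exists (inord 1)
    | exists (inord 2) | exists (inord 3)]; rewrite inordK.
- case=> -[|[|[|[|i]]]] //= lti; rewrite /form_coefs /=.
  + by move/negPf=> x00; move: e0; rewrite x00 size_poly1 /= => ->.
  + move/negPf=> x10; move: e1; rewrite x10 size_polyN odd_size // degM // oddD.
    by case: odd; case: odd; case: (e).
  + by move/negPf=> x20; move: e2; rewrite x20 size_polyN odd_size //;
      case: odd; case: (e).
  + move/negPf=> x30; move: e3; rewrite x30 odd_size // degM // oddD.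
    by case: odd; case: odd; case: (e).
- rewrite sum_ord4 /form_coefs !inordK //= lead_coef1 !lead_coefN !lead_coefM.
  by rewrite -[RHS]sum0; ring.
Qed.

Let ternary (b0 b1 b2 : E) : b0 != 0 -> b1 != 0 -> b2 != 0 ->
  exists x0 x1 x2, [|| x0 != 0, x1 != 0 | x2 != 0] /\
    b0 * x0 ^+ 2 + b1 * x1 ^+ 2 + b2 * x2 ^+ 2 = 0.
Proof.
move=> nz0 nz1 nz2; have [|x [[i xi] sum0]] := @ternary_zero E (fun i =>
  [:: b0; b1; b2]`_i) uE.
  by case=> -[|[|[|i]]].
rewrite !big_ord_recl big_ord0 addr0 addrA /= in sum0.
exists (x ord0), (x (lift ord0 ord0)), (x (lift ord0 (lift ord0 ord0)));
  split=> //.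
case: i xi => -[|[|[|i]]] //= lti xi; apply/or3P;
  [apply: Or31 | apply: Or32 | apply: Or33]; apply: contraNneq xi => <-;
    apply/eqP; congr (x _); exact: val_inj.
Qed.

(** The degrees of the four entries have an odd sum, so that three of them have
    the same parity. *)
Lemma isotropic_at_infinity_odd_degree : odd (size f).-1 ->
  isotropic_over_completion v (diag_mx (\row_i tofrac (form_coefs f g h i))).
Proof.
move=> f_odd; have hf0 : - (lead_coef h * lead_coef f) != 0
  by rewrite oppr_eq0 mulf_neq0.
have Ng0 : - lead_coef g != 0 by rewrite oppr_eq0.
have hg0 : lead_coef h * lead_coef g != 0 by rewrite mulf_neq0.
have one0 := oner_neq0 E.
have [g_odd|g_even] := boolP (odd (size g).-1);
  have [h_odd|h_even] := boolP (odd (size h).-1).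
- have [x [y [z [nz sum0]]]] := ternary one0 hf0 hg0.
  apply: (@isotropic_at_infinity_of_zero x y 0 z true).
  + by rewrite eqxx.
  + by rewrite -[RHS]sum0; ring.
  + by rewrite f_odd g_odd h_odd eqxx !orbT.
- have [x [y [z [nz sum0]]]] := ternary hf0 Ng0 hg0.
  apply: (@isotropic_at_infinity_of_zero 0 x y z false).
  + by rewrite eqxx.
  + by rewrite -[RHS]sum0; ring.
  + by rewrite f_odd g_odd (negPf h_even) eqxx !orbT.
- have [x [y [z [nz sum0]]]] := ternary one0 hf0 Ng0.
  apply: (@isotropic_at_infinity_of_zero x y z 0 true).
  + by rewrite eqxx orbF.
  + by rewrite -[RHS]sum0; ring.
  + by rewrite f_odd h_odd (negPf g_even) eqxx !orbT.
- have [x [y [z [nz sum0]]]] := ternary one0 Ng0 hg0.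
  apply: (@isotropic_at_infinity_of_zero x 0 y z true).
  + by rewrite eqxx.
  + by rewrite -[RHS]sum0; ring.
  + by rewrite (negPf g_even) (negPf h_even) eqxx !orbT.
Qed.

(** Unless all degrees are even, the entries form two pairs according to the
    parity of the degree; the norm of g modulo f decides which pair is
    isotropic: one if it is a square, the other if it is lc(f) times a square.
    *)
Lemma isotropic_at_infinity_even_degree (k k' : {poly E}) (s : E) :
    ~~ odd (size f).-1 -> unit_mod g f ->
    unit_mod g k -> eq_mod g h (f * k ^+ 2) ->
    unit_mod h k' -> eq_mod h g (1 * k' ^+ 2) ->
    s != 0 -> norm_mod f g = s ^+ 2 \/ norm_mod f g = lead_coef f * s ^+ 2 ->
  isotropic_over_completion v (diag_mx (\row_i tofrac (form_coefs f g h i))).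
Proof.
move=> f_even fg k_unit hfk k'_unit gk s0 Ns.
have [t t0] := norm_class_at_infinity f0 g0 h0 fg k_unit k'_unit hfk gk f_even.
set lf := lead_coef f; set lg := lead_coef g; set lh := lead_coef h.
have one0 := oner_neq0 E.
have [g_odd|g_even] := boolP (odd (size g).-1);
  have [h_odd|h_even] := boolP (odd (size h).-1);
  rewrite /= ?expr1 ?expr0 ?mul1r ?mulr1 => DN; rewrite DN in Ns.
- case: Ns => Ns.
  + apply: (@isotropic_at_infinity_of_zero 0 1 (lh * lf * t / s) 0 false).
    * by rewrite one0 orbT.
    * rewrite -/lf -/lg -/lh expr0n /= mulr0 addr0 expr1n mulr1 sub0r.
      rewrite (_ : lg * _ = - (lh * lf) * (- 1 * lg * (lh * lf) * t ^+ 2)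
        / s ^+ 2); last by field.
      by rewrite Ns; field.
    * by rewrite h_odd g_odd (negPf f_even) eqxx !orbT.
  + apply: (@isotropic_at_infinity_of_zero 1 0 0 (t / s) true).
    * by rewrite one0.
    * have Ns' : - 1 * lg * lh * t ^+ 2 = s ^+ 2.
        by apply: (mulfI lf0); rewrite -/lf -Ns /lf /lg /lh; ring.
      rewrite -/lf -/lg -/lh expr0n /= !mulr0 !subr0 expr1n -[1](divff
        (expf_neq0 2 s0)) -{1}Ns'.
      by field.
    * by rewrite h_odd g_odd eqxx !orbT.
- case: Ns => Ns.
  + apply: (@isotropic_at_infinity_of_zero 1 (t / s) 0 0 true).
    * by rewrite one0.
    * rewrite -/lf -/lg -/lh expr0n /= !mulr0 subr0 addr0 expr1n.
      by rewrite expr_div_n mulrA [_ * t ^+ 2]Ns divff ?expf_neq0 // subrr.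
    * by rewrite (negPf h_even) (negPf f_even) eqxx !orbT.
  + apply: (@isotropic_at_infinity_of_zero 0 0 1 (t / s) false).
    * by rewrite one0 !orbT.
    * have Ns' : lh * t ^+ 2 = s ^+ 2.
        by apply: (mulfI lf0); rewrite -/lf -Ns /lf /lh; ring.
      rewrite -/lf -/lg -/lh expr0n /=
        !mulr0 subr0 sub0r expr1n mulr1 expr_div_n -Ns'.
      by field; rewrite lh0 t0.
    * by rewrite (negPf h_even) g_odd eqxx !orbT.
- case: Ns => Ns.
  + apply: (@isotropic_at_infinity_of_zero 1 0 (t / s) 0 true).
    * by rewrite one0.
    * rewrite -/lf -/lg -/lh expr0n /= !mulr0 subr0 addr0 expr1n.
      by rewrite expr_div_n mulrA [_ * t ^+ 2]Ns divff ?expf_neq0 // subrr.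
    * by rewrite (negPf g_even) eqxx !orbT.
  + apply: (@isotropic_at_infinity_of_zero 0 1 0 (t / s) false).
    * by rewrite one0 !orbT.
    * rewrite -/lf -/lg -/lh expr0n /=
        !mulr0 subr0 sub0r expr1n mulr1 expr_div_n.
      rewrite mulrA -[lh * lg * _]mulrA [lg * _]Ns -/lf mulrA mulfK
        ?expf_neq0 //.
      by rewrite addNr.
    * by rewrite h_odd (negPf f_even) (negPf g_even) eqxx !orbT.
- have Ng0 : - lg != 0 by rewrite oppr_eq0.
  have hg0 : lh * lg != 0 by rewrite mulf_neq0.
  have [x [y [z [nz sum0]]]] := ternary one0 Ng0 hg0.
  apply: (@isotropic_at_infinity_of_zero x 0 y z true).
  + by rewrite eqxx.
  + by rewrite -/lf -/lg -/lh -[RHS]sum0; ring.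
  + by rewrite (negPf g_even) (negPf h_even) eqxx !orbT.
Qed.

End AtInfinity.

(** * The form and its isotropy *)

Section UnitsModulo.

Variable E : fieldType.
Implicit Types a b f u : {poly E}.

Lemma unit_modP f a : unit_mod f a <-> coprimep f a.
Proof.
split=> [[b /dvdpP [c Dab]]|/Bezout_eq1_coprimepP [[k l] /= Dkl]].
  by apply/Bezout_eq1_coprimepP; exists (- c, b) => /=; rewrite mulNr -Dab;
    ring.
by exists l; rewrite /eq_mod -Dkl (_ : _ - _ = - k * f) ?dvdp_mull //; ring.
Qed.

Lemma eq_mod_coprimep f a b : eq_mod f a b -> coprimep f a = coprimep f b.
Proof.
move=> /dvdpP [c Dab]; rewrite -[a](subrK b) Dab.
exact: coprimep_addl_mul.
Qed.

Lemma dvdp_eq_mod f p a b : eq_mod f a b -> p %| f -> p %| a - b.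
Proof. by move=> fab pf; apply: dvdp_trans fab. Qed.

(** A square root of a b modulo f, divided by a, witnesses that a and b are in
    the same square class. *)
Lemma local_square_class f a b :
    square_free f -> coprimep f a -> coprimep f b ->
    (forall p, irreducible_poly p -> p %| f -> sq_mod p (a * b)) ->
  in_square_class_mod f a b.
Proof.
move=> fsq fa fb loc; have [e fe] := sqrt_mod fsq loc.
have [a' aa'] := (unit_modP f a).2 fa.
have fe' : coprimep f e.
  have : coprimep f (e ^+ 2) by rewrite -(eq_mod_coprimep fe) coprimepMr fa.
  by rewrite coprimep_pexpr.
have fa' : coprimep f a'.
  have : coprimep f (a * a') by rewrite (eq_mod_coprimep aa') coprimep1.
  by rewrite coprimepMr => /andP [].
exists (e * a'); first by apply/unit_modP; rewrite coprimepMr fe'.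
rewrite /eq_mod (_ : _ - _ = (a * b - e ^+ 2) * (a * a' ^+ 2)
  - (a * a' - 1) * ((a * a' + 1) * b)); last by ring.
by apply: dvdp_sub; apply: dvdp_mulr.
Qed.

End UnitsModulo.

(** E[X]/(f) is the zero ring. *)
Lemma constant_square_reflexive (E : fieldType) (f a : {poly E}) :
    size f = 1%N ->
  exists g, [/\ g != 0, coprimep g f, in_square_class_mod f a g
    & in_square_class_mod g 1 f].
Proof.
move=> f1; exists 1; have dvd_f u : f %| u by apply: dvdp_trans (dvd1p _);
  rewrite dvdp1 f1.
split; rewrite ?oner_neq0 ?coprime1p //.
  by exists 1; [exists 1; apply: dvd_f | apply: dvd_f].
by exists 1; [exists 1; apply: dvd1p | apply: dvd1p].
Qed.

Section Construction.

Variables (E : fieldType) (f g h k k' : {poly E}).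
Hypotheses (two0 : 2 != 0 :> E) (uE : forall E' : fieldExtType E, u_le E' 2).
Hypotheses (fsq : square_free f) (f_gt1 : (1 < size f)%N) (gsq : square_free g).
Hypotheses (fg : coprimep f g) (hg : coprimep h g) (h0 : h != 0).
Hypotheses (hfk : eq_mod g h (f * k ^+ 2)) (gk : eq_mod h g (1 * k' ^+ 2)).

Let f0 : f != 0. Proof. exact: square_free_neq0. Qed.
Let g0 : g != 0. Proof. exact: square_free_neq0. Qed.

Lemma hf_square_mod_g p : irreducible_poly p -> p %| g -> sq_mod p (h * f).
Proof.
move=> _ pg; apply: sq_mod_eq (sq_modX2 p (f * k)).
rewrite (_ : _ - _ = - f * (h - f * k ^+ 2)); last by ring.
by apply: dvdp_mull; apply: dvdp_eq_mod hfk pg.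
Qed.

Lemma g_square_mod_h p : irreducible_poly p -> p %| h -> sq_mod p g.
Proof.
by move=> _ ph; exists k'; rewrite -[k' ^+ 2]mul1r; apply: dvdp_eq_mod gk ph.
Qed.

Lemma form_det : has_determinant (diag_mx (\row_i tofrac (form_coefs f g h i)))
  (tofrac f).
Proof.
exists (tofrac (h * g)); first by rewrite tofrac_eq0 mulf_neq0.
rewrite det_diag !big_ord_recl big_ord0 !mxE /form_coefs /= tofrac1 mul1r mulr1.
by rewrite !tofracN !tofracM; ring.
Qed.

(** An isotropic vector over E(X) becomes one over E[X], from which a reflecting
    polynomial is read off. *)
Lemma form_anisotropic :
    (forall G : {poly E}, square_free G ->
       (forall p, irreducible_poly p -> p %| G -> ~~ (p %| f) /\ sq_mod p f) ->
       (forall p, irreducible_poly p -> p %| f -> sq_mod p (g * G)) -> False) ->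
  anisotropic (diag_mx (\row_i tofrac (form_coefs f g h i))).
Proof.
move=> noG [x x0]; rewrite qform_diag => sum0.
have [c c0 [y Dy]] := clear_denominators x.
have sumy : \sum_i form_coefs f g h i * y i ^+ 2 = 0.
  apply/eqP; rewrite -tofrac_eq0 rmorph_sum; apply/eqP.
  transitivity (tofrac c ^+ 2 *
    \sum_i (\row_i tofrac (form_coefs f g h i)) 0 i * x 0 i ^+ 2).
    rewrite mulr_sumr; apply: eq_bigr => i _.
    by rewrite mxE rmorphM rmorphXn /= -Dy exprMn; ring.
  by rewrite sum0 mulr0.
rewrite sum_ord4 /form_coefs !inordK //= in sumy.
have [||G [Gsq Gf fG]] := @reflecting_polynomial E f g h fsq f_gt1 gsq fg hg
  hf_square_mod_g g_square_mod_h
  (y (inord 3)) (y (inord 0)) (y (inord 1)) (y (inord 2)).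
- apply: contraNT x0; rewrite !negb_or !negbK =>
    /and4P [/eqP y3 /eqP y0 /eqP y1 /eqP y2].
  apply/eqP/rowP => i; rewrite mxE; apply: (mulfI (_ : tofrac c != 0));
    first by rewrite tofrac_eq0.
  have yi0 : y i = 0.
    by rewrite -[i]inord_val; case: i => -[|[|[|[|i]]]].
  by rewrite Dy yi0 tofrac0 mulr0.
- by rewrite -[RHS]sumy; ring.
- exact: noG Gsq Gf fG.
Qed.

Lemma form_isotropic_finite (v : ratfun E -> int) :
    Omega v -> 0 <= v (tofrac 'X) ->
  isotropic_over_completion v (diag_mx (\row_i tofrac (form_coefs f g h i))).
Proof.
move=> vO vX; apply: (finite_place_isotropic vO two0 vX) => p p_irr.
have pN1 : ~~ (p %| 1) by rewrite irred_dvdp_const ?size_poly1.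
have [ph|pNh] := boolP (p %| h).
  exists (fun i : 'I_4 => [:: k'; 0; 1; 0]`_i); split.
    exists (inord 2); rewrite /form_coefs inordK //= mulr1 dvdpNr.
    exact: coprimep_irred_ndvd hg ph.
  rewrite sum_ord4 /form_coefs !inordK //=.
  rewrite (_ : _ + _ = - (g - 1 * k' ^+ 2)); last by ring.
  by rewrite dvdpNr; apply: dvdp_eq_mod gk ph.
have [pg|pNg] := boolP (p %| g).
  exists (fun i : 'I_4 => [:: f * k; 1; 0; 0]`_i); split.
    exists (inord 1); rewrite /form_coefs inordK //= mulr1 dvdpNr irred_dvdpM //.
    rewrite (negPf pNh) /=.
    by apply: coprimep_irred_ndvd pg; rewrite // coprimep_sym.
  rewrite sum_ord4 /form_coefs !inordK //=.
  rewrite (_ : _ + _ = - f * (h - f * k ^+ 2)); last by ring.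
  by apply: dvdp_mull; apply: dvdp_eq_mod hfk pg.
have [|x [[i pNx] px]] := @residue_ternary E p (fun i => [:: 1; - g;
  h * g]`_i) uE p_irr.
  by case=> -[|[|[|i]]] //= lti; rewrite ?dvdpNr ?irred_dvdpM ?(negPf pNh).
pose x0 := x ord0; pose x1 := x (lift ord0 ord0);
  pose x2 := x (lift ord0 (lift ord0 ord0)).
exists (fun i : 'I_4 => [:: x0; 0; x1; x2]`_i); split.
  have Dx (j : 'I_3) l : j = l :> nat -> x j = [:: x0; x1; x2]`_l.
    move=> <-; case: j => -[|[|[|j]]] //= ltj; congr (x _); exact: val_inj.
  move: pNx; rewrite (Dx i i) //; case: i => -[|[|[|i]]] //= lti pNx;
    [exists (inord 0) | exists (inord 2) | exists (inord 3)];
    by rewrite /form_coefs inordK //= irred_dvdpM // negb_or pNx ?dvdpNr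
      ?irred_dvdpM ?(negPf pNh) ?andbT.
rewrite !big_ord_recl big_ord0 /= in px.
rewrite sum_ord4 /form_coefs !inordK //=.
by rewrite (_ : _ + _ = 1 * x0 ^+ 2 + (- g * x1 ^+ 2 + (h * g * x2 ^+ 2 + 0)))
  //; ring.
Qed.

End Construction.

Theorem lemma6p8 (E : fieldType) (charE : 2%N \notin [pchar E])
    (uE : forall E' : fieldExtType E, u_le E' 2)
    (f : {poly E}) (f_sqfree : square_free f) (f_nrefl : ~ square_reflexive f)
    (f_min : forall h : {poly E},
       square_free h -> ~ square_reflexive h -> (size f <= size h)%N) :
  exists A : 'M[ratfun E]_4,
    [/\ regular_form A, anisotropic A, has_determinant A (tofrac f)
      & forall v : ratfun E -> int, Omega v -> isotropic_over_completion v A].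
Proof.
have two0 : 2 != 0 :> E by move: charE; rewrite inE.
have f0 := square_free_neq0 f_sqfree.
have [a [a_unit [r r0 Nr] noG]] : exists a, [/\ unit_mod f a,
    exists2 r : E, r != 0 & norm_mod f a = r ^+ 2 \/ norm_mod f a =
      lead_coef f * r ^+ 2
  & ~ exists G : {poly E}, [/\ G != 0, coprimep G f, in_square_class_mod f a G
        & in_square_class_mod G 1 f]].
  apply: NNPP => all_good; apply: f_nrefl => a a_unit Na.
  by apply: NNPP => noG; apply: all_good; exists a.
have f_gt1 : (1 < size f)%N.
  rewrite ltn_neqAle eq_sym size_poly_gt0 f0 andbT; apply/eqP => f1.
  exact: noG (constant_square_reflexive a f1).
have fa : coprimep f a by apply/unit_modP.
have fam : coprimep f (a %% f) by rewrite coprimep_modr.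
have am0 : a %% f != 0.
  apply: contraTneq fam => ->; rewrite coprimep0 -size_poly_eq1.
  by rewrite neq_ltn f_gt1 orbT.
have [s [g1 [Da s0 g1sq]]] := square_free_part am0.
have g10 := square_free_neq0 g1sq.
have [fs fg1] : coprimep f s /\ coprimep f g1.
  by move: fam; rewrite Da coprimepMr coprimep_pexpr // => /andP.
have n0 : norm_mod g1 f != 0.
  by apply: norm_mod_neq0 => //; apply/unit_modP; rewrite coprimep_sym.
(* This constant makes the leading coefficient of g the norm of f modulo g. *)
pose c := norm_mod g1 f / lead_coef g1.
have c0 : c != 0 by rewrite mulf_neq0 // invr_eq0 lead_coef_eq0.
pose g := c *: g1.
have g0 : g != 0 by rewrite scaler_eq0 negb_or c0.
have gsq : square_free g.
  apply: square_free_dvd g1sq _; rewrite dvdpZl ?dvdpp //.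
have fg : coprimep f g by rewrite coprimepZr.
have g_unit : unit_mod g f by apply/unit_modP; rewrite coprimep_sym.
have g_refl : square_reflexive g.
  apply: NNPP => /(f_min g gsq); rewrite size_scale // leqNgt => /negP; apply.
  apply: leq_ltn_trans (_ : (size (a %% f)%R < size f)%N);
    last by rewrite ltn_modp.
  by apply: dvdp_leq => //; rewrite Da dvdp_mull.
have [|h [h0 hg [k k_unit hfk] [k' k'_unit gk]]] := g_refl f g_unit.
  exists 1; first exact: oner_neq0.
  by right; rewrite norm_modZl // lead_coefZ divfK
    ?lead_coef_eq0 // expr1n mulr1.
exists (diag_mx (\row_i tofrac (form_coefs f g h i))); split.
- by apply: diag_regular => i; rewrite mxE tofrac_eq0 form_coefs_neq0.
- apply: (form_anisotropic f_sqfree f_gt1 gsq fg hg hfk gk) => G Gsq Gf fG.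
  have G0 := square_free_neq0 Gsq.
  have fcG : coprimep f (c *: G).
    rewrite coprimepZr // coprimep_sym; apply: coprimep_irredP => // p p_irr pG.
    by case: (Gf p p_irr pG).
  apply: noG; exists (c *: G); split.
  + by rewrite scaler_eq0 negb_or c0.
  + by rewrite coprimep_sym.
  + apply: local_square_class => // p p_irr pf.
    apply: sq_mod_eq (sq_modM (sq_modX2 p s) (fG p p_irr pf)).
    rewrite (_ : _ - _ = c *: ((a %% f - a) * G)); last first.
      by rewrite Da /g -!mul_polyC; ring.
    rewrite dvdpZr // dvdp_mulr // (dvdp_trans pf) //.
    rewrite -opprB dvdpNr {1}(divp_eq a f) addrK; exact: dvdp_mull.
  + apply: local_square_class; rewrite ?coprimep1 //.
    * by apply: square_free_dvd Gsq _; rewrite dvdpZl.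
    * by rewrite coprimep_sym.
    * by move=> p p_irr; rewrite dvdpZr // mul1r => /(Gf p p_irr) [].
- exact: form_det.
move=> v vO; have [vX|vX] := leP 0 (v (tofrac 'X)).
  exact: (form_isotropic_finite two0 uE fg hg hfk gk vO vX).
have [f_odd|f_even] := boolP (odd (size f).-1).
  exact: (isotropic_at_infinity_odd_degree two0 uE vO vX).
have Ng : norm_mod f a = norm_mod f s ^+ 2 * norm_mod f g1.
  rewrite -norm_modX2 // -norm_modM // -Da; apply: norm_mod_eq.
  by rewrite {1}(divp_eq a f) addrK dvdp_mull.
have Ngc : norm_mod f g = (c ^+ (size f).-1./2) ^+ 2 * norm_mod f g1.
  rewrite /g -mul_polyC norm_modM // norm_modC // expr_parity (negPf f_even).
  by rewrite mul1r.
have Ns0 : norm_mod f s != 0 by apply: norm_mod_neq0 => //; apply/unit_modP.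
apply: (isotropic_at_infinity_even_degree (s := c ^+
  (size f).-1./2 * r / norm_mod f s)
  two0 uE vO vX f0 g0 h0 f_even g_unit k_unit hfk k'_unit gk).
  by rewrite !mulf_neq0 ?invr_neq0 ?expf_neq0.
have Dg1 : norm_mod f g1 = norm_mod f a / norm_mod f s ^+ 2.
  by rewrite Ng mulrAC divff ?mul1r // expf_neq0.
by rewrite Ngc Dg1; case: Nr => ->; [left | right]; field.
Qed.
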